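(* Let $\gamma\subseteq\mathbb P^2$ be an irreducible conic and let $X=\mathbb S(\mathcal L)$ and $Y=\mathbb S(\mathcal M)$ be two contact star configurations on $\gamma$, where $\mathcal L=\{\ell_1,\ldots,\ell_r\}$ and $\mathcal M=\{m_1,\ldots,m_s\}$ are two sets of lines tangent to $\gamma$, with $r,s\ge2$ and the $r+s$ lines $\ell_1,\ldots,\ell_r,m_1,\ldots,m_s$ distinct. Then: (a) if $s=r-1$, then the general form in $(I_{X\cup Y})_{r-1}$ is irreducible; (b) if $s=r-1$, then $X\cup Y$ is a complete intersection of type $(r-1,r-1)$; (c) if $s=r$, then the general form in $(I_{X\cup Y})_r$ is irreducible; (d) if $s=r$, then $(I_{X\cup Z})_{r-1}=(I_{X\cup Y})_{r-1}$, where $Z$ denotes a set of $r-1$ collinear points in $Y$; (e) if $s=r$, then $X\cup Y$ is a complete intersection of type $(r-1,r)$.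
   Context: Work over $\mathbb C$ with $S=\mathbb C[x,y,z]=\mathbb C[\mathbb P^2]$. A set of $r\ge2$ lines in $\mathbb P^2$ meets properly if the lines are distinct and no three of them are concurrent; the star configuration $\mathbb S(\ell_1,\ldots,\ell_r)$ defined by such lines is the set of the $\binom r2$ points $\ell_i\cap\ell_j$, $i<j$. A contact star configuration on an irreducible conic $\gamma$ is a star configuration $\mathbb S(\ell_1,\ldots,\ell_r)$ where $\ell_1,\ldots,\ell_r$ are the tangent lines to $\gamma$ at $r$ distinct points of $\gamma$ (such lines always meet properly). For a finite set of points $X\subseteq\mathbb P^2$, $I_X\subseteq S$ is the homogeneous ideal of all forms vanishing on $X$ and $(I_X)_d$ is its degree $d$ part. A finite set $X$ is a complete intersection of type $(a,b)$ if $I_X$ is generated by two forms of degrees $a$ and $b$ (having no common component). ''The general form in $(I_X)_d$'' means every form in some nonempty Zariski-open subset of the vector space $(I_X)_d$. *)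

(* Defs.v *)
From HB Require Import structures.
From mathcomp Require Import all_boot all_order all_algebra.
From mathcomp Require Import finmap mpoly complex reals.

Set Implicit Arguments.
Unset Strict Implicit.
Unset Printing Implicit Defensive.

Import Order.TTheory GRing.Theory Num.Theory.
Local Open Scope ring_scope.

(* A point (resp. a line) of P^2 is a 1- (resp. 2-) dimensional subspace of
   K^3, so that incidence is inclusion of subspaces. *)
Definition point (K : fieldType) := {U : {vspace 'rV[K]_3} | \dim U == 1%N}.
Definition line (K : fieldType) := {U : {vspace 'rV[K]_3} | \dim U == 2%N}.

Definition incident (K : fieldType) (p : point K) (l : line K) : bool :=
  (val p <= val l)%VS.

(* Only meaningful for f homogeneous. *)
Definition vanishes_at (K : fieldType) (f : {mpoly K[3]}) (p : point K) : Prop :=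
  forall v : 'rV[K]_3, v \in val p -> f.@[v 0] = 0.

Definition irreducible_elt (A : idomainType) (a : A) : Prop :=
  [/\ a != 0, a \isn't a GRing.unit &
      forall b c : A, a = b * c -> b \is a GRing.unit \/ c \is a GRing.unit].

(* An irreducible conic is given by its equation. *)
Definition irreducible_conic (K : fieldType) (q : {mpoly K[3]}) : Prop :=
  q \is 2.-homog /\ irreducible_elt q.

Definition tangent_at (K : fieldType) (q : {mpoly K[3]}) (p : point K)
    (l : line K) : Prop :=
  forall v : 'rV[K]_3, v \in val p -> v != 0 ->
  forall w : 'rV[K]_3,
    (w \in val l) = (\sum_(i < 3) (mderiv i q).@[v 0] * w 0 i == 0).

Definition contact_lines (K : fieldType) (q : {mpoly K[3]}) (r : nat)
    (l : 'I_r -> line K) : Prop :=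
  exists t : 'I_r -> point K,
    injective t /\
    forall i, vanishes_at q (t i) /\ tangent_at q (t i) (l i).

Definition star (K : fieldType) (r : nat) (l : 'I_r -> line K) :
    pred (point K) :=
  fun p => [exists i : 'I_r, exists j : 'I_r,
             [&& (i < j)%N, incident p (l i) & incident p (l j)]].

Definition generated_ideal (A : comNzRingType) (G : A -> Prop) (a : A) : Prop :=
  exists s : seq (A * A),
    (forall x, x \in s -> G x.2) /\ a = \sum_(x <- s) x.1 * x.2.

Definition vanishing_ideal (K : fieldType) (X : pred (point K)) :
    {mpoly K[3]} -> Prop :=
  generated_ideal (fun f : {mpoly K[3]} =>
    (exists d : nat, f \is d.-homog) /\ forall p, X p -> vanishes_at f p).

Definition vanishing_forms (K : fieldType) (X : pred (point K)) (d : nat)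
    (f : dhomog 3 K d) : Prop :=
  vanishing_ideal X (mpoly_of_dhomog f).

(* In the mpoly ring over a field the units are the nonzero constants. *)
Definition no_common_component (K : fieldType) (f g : {mpoly K[3]}) : Prop :=
  forall h : {mpoly K[3]},
    (exists a, f = h * a) -> (exists b, g = h * b) -> h \is a GRing.unit.

Definition complete_intersection (K : fieldType) (d e : nat)
    (X : pred (point K)) : Prop :=
  exists f g : {mpoly K[3]},
    [/\ f \is d.-homog, g \is e.-homog, no_common_component f g &
        forall h, vanishing_ideal X h <->
                  generated_ideal (fun k => k = f \/ k = g) h].

(* The coordinates are taken in some basis of V; the resulting topology does
   not depend on it. *)
Definition zariski_open (K : fieldType) (V : vectType K) (U : V -> Prop) : Prop :=
  exists F : {mpoly K[\dim {:V}]} -> Prop,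
    forall v : V,
      U v <-> exists2 P, F P & P.@[fun i => coord (vbasis {:V}) i v] != 0.

(* For W a linear subspace of V, the Zariski topology of W is the one induced
   by V: its open sets are the traces on W of the open sets of V. *)
Definition general_in (K : fieldType) (V : vectType K) (W : V -> Prop)
    (P : V -> Prop) : Prop :=
  exists U : V -> Prop,
    [/\ zariski_open U, (exists v, W v /\ U v) & forall v, W v -> U v -> P v].

Definition general_form_irreducible (K : fieldType) (X : pred (point K))
    (d : nat) : Prop :=
  general_in (@vanishing_forms K X d)
    (fun f : dhomog 3 K d => irreducible_elt (mpoly_of_dhomog f)).

Definition collinear (K : fieldType) (Z : {fset point K}) : Prop :=
  exists l : line K, forall p, p \in Z -> incident p l.

(* Main.v *)
Require Import Defs.
From HB Require Import structures.
From mathcomp Require Import all_boot all_order all_algebra.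
From mathcomp Require Import finmap mpoly complex reals.
From mathcomp Require Import ring zify.
From Stdlib Require Import Classical.

Set Implicit Arguments.
Unset Strict Implicit.
Unset Printing Implicit Defensive.

Import Order.TTheory GRing.Theory Num.Theory.
Local Open Scope ring_scope.

(* In suitable coordinates the tangents of the conic are the lines z t^2 - x t + y = 0, and the
   tangents with parameters a and b meet at (a + b : ab : 1).  Let A and B be the monic
   polynomials whose roots are the parameters of the two sets of lines.  The Bezoutian
   F = (A(a) B(b) - A(b) B(a)) / (a - b) is symmetric in a and b, hence a form in x, y, z, and it
   vanishes on both stars.  If s = r - 1, the Bezoutians of A with B and with T B generate the
   ideal; if s = r, the Bezoutian F and G = A(a) B(b) + A(b) B(a) do: a form vanishing on both
   stars is a multiple of F on one of the tangents, and dividing the difference by the equation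
   of that tangent removes one line from the configuration.

   Irreducibility in the pencil of (a): suppose infinitely many members factor.  Two of the
   factorisations split the points of the first star in the same way; on each tangent the factors
   are then determined up to a scalar, and comparing these scalars at the points of the star shows
   that the two members share a factor, which is absurd.  For (c), an irreducible member of the
   system is obtained from (a) by adding one tangent, and irreducibility is an open condition:
   a factorisation distributes the points of both stars, and the residual points on the tangents,
   among two forms of smaller degree. *)

(** * Homogeneous polynomials *)

(** The conic is [x^2 = 4 y z], where the discriminant of [z t^2 - x t + y] vanishes, and a form of
    degree [n] becomes a symmetric polynomial of degree at most [n] in each of [a] and [b]. This
    needs every tangent to have a finite parameter, so the coordinates are adapted to a point of the
    conic that is none of the contact points. Generation is an induction that adds a tangent to each
    set in turn: the case [s = r - 1] yields the case [s = r] and conversely, starting from one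
    tangent and none, where there are no points. In (c) the stars alone leave a system of dimension
    4. On each tangent a member of degree [r] passes through the [r - 1] points of the star and one
    residual point, which moves with the member. The irreducible member can be taken with residual
    points on an extra tangent [t] for the first star and [t'] for the second; up to a scalar it is
    the only form of its degree through all these points, so no nonzero product of forms of smaller
    degree passes through them. That property is a rank condition, hence visibly open. *)

Lemma digits_inj n N (m m' : 'I_n -> nat) :
  (forall i, m i < N)%N -> (forall i, m' i < N)%N ->
  (\sum_(i < n) m i * N ^ i = \sum_(i < n) m' i * N ^ i)%N -> m =1 m'.
Proof.
elim: n m m' => [|n IHn] m m' ltm ltm' eq_s; first by case.
have N_gt0 : (0 < N)%N by apply: leq_ltn_trans (ltm ord0).
have shiftE (u : 'I_n.+1 -> nat) : (\sum_(i < n.+1) u i * N ^ i =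
    (\sum_(i < n) u (lift ord0 i) * N ^ i) * N + u ord0)%N.
  rewrite big_ord_recl expn0 muln1 addnC big_distrl /=; congr addn.
  by apply: eq_bigr => i _; rewrite -mulnA -expnSr.
rewrite !shiftE in eq_s.
have eq0 : m ord0 = m' ord0.
  by have := congr1 (modn^~ N) eq_s; rewrite /= !modnMDl !modn_small.
have eqS : (fun i => m (lift ord0 i)) =1 (fun i => m' (lift ord0 i)).
  apply: IHn => [i|i|]; [exact: ltm|exact: ltm'|].
  by move/eqP: eq_s; rewrite eq0 eqn_add2r eqn_pmul2r // => /eqP.
by move=> i; case: (unliftP ord0 i) => [j|] ->; [exact: eqS|].
Qed.

Lemma mem_roots_eq0 (K : numDomainType) (p : {poly K}) :
  (forall a, p.[a] = 0) -> p = 0.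
Proof.
move=> p0; apply/eqP/negPn/negP => p_neq0.
pose rs : seq K := [seq i%:R | i <- iota 0 (size p)].
have rs_uniq : uniq rs by rewrite map_inj_uniq ?iota_uniq // => i j /eqP; rewrite eqr_nat => /eqP.
have rs_root : all (root p) rs by apply/allP => a _; rewrite rootE p0.
by have := max_poly_roots p_neq0 rs_root rs_uniq; rewrite size_map size_iota ltnn.
Qed.

(* Kronecker substitution 'X_i := 'X^(N^i), N bounding the exponents. *)
Lemma mpoly_eval_eq0 (K : numDomainType) n (f : {mpoly K[n]}) :
  (forall v : 'I_n -> K, f.@[v] = 0) -> f = 0.
Proof.
move=> f0; pose N := msize f.
pose e (m : 'X_{1..n}) := (\sum_(i < n) m i * N ^ i)%N.
pose p : {poly K} := \sum_(m <- msupp f) f@_m *: 'X^(e m).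
have p0 : p = 0.
  apply: mem_roots_eq0 => a; rewrite horner_sum -[RHS](f0 (fun i => a ^+ (N ^ i))) mevalE.
  apply: eq_bigr => m _; rewrite hornerZ hornerXn /e -prodrXr; congr (_ * _).
  by apply: eq_bigr => i _; rewrite -exprM mulnC.
have ltN m : m \in msupp f -> forall i, (m i < N)%N.
  move=> mf i; apply: leq_trans (msize_mdeg_lt mf); rewrite ltnS mdegE.
  by rewrite (bigD1 i) //= leq_addr.
apply/mpolyP => m; rewrite mcoeff0.
case: (boolP (m \in msupp f)) => [mf|]; last by move/memN_msupp_eq0.
have := congr1 (fun r : {poly K} => r`_(e m)) p0.
rewrite coef0 coef_sum (bigD1_seq m) //= ?msupp_uniq // big_seq_cond big1 => [|m' /andP[m'f nm]].
  by rewrite coefZ coefXn eqxx mulr1 addr0.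
rewrite coefZ coefXn [e m == _]eq_sym; case: eqP => [ee|_]; last by rewrite mulr0.
case/eqP: nm; apply/mnmP; exact: (digits_inj (ltN _ m'f) (ltN _ mf) ee).
Qed.

(** One of the two factors vanishes at 0 and can be divided by ['X]. Used with forms as
    coefficients: the grading below turns a form into a monomial, so that factors of forms are
    forms. *)
Lemma poly_monomial_factor (A : idomainType) (p q : {poly A}) c d :
  c != 0 -> p * q = c%:P * 'X^d -> exists i c', p = c'%:P * 'X^i.
Proof.
move=> c0; elim: d p q => [|d IHd] p q pqE.
  have pq0 : p * q != 0 by rewrite pqE expr0 mulr1 polyC_eq0.
  move: (pq0); rewrite mulf_eq0 negb_or => /andP[p0 q0].
  have := congr1 (fun r : {poly A} => size r) pqE.
  rewrite expr0 mulr1 size_polyC c0 size_mul // => s1.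
  have /size_poly1P [c' _ ->] : size p == 1.
    by move: p0 q0 s1; rewrite -!size_poly_gt0; lia.
  by exists 0%N, c'; rewrite expr0 mulr1.
have : p.[0] * q.[0] = 0.
  by rewrite -hornerM pqE hornerM hornerXn expr0n mulr0.
have X0 : 'X != 0 :> {poly A} by rewrite polyX_eq0.
move/eqP; rewrite mulf_eq0 => /orP[] /factor_theorem [r]; rewrite subr0 => rE.
  have [|i [c' r'E]] := IHd r q.
    by apply: (mulIf X0); rewrite mulrAC -rE pqE exprSr mulrA.
  by exists i.+1, c'; rewrite rE r'E exprSr mulrA.
by apply: (IHd p r); apply: (mulIf X0); rewrite -mulrA -rE pqE exprSr mulrA.
Qed.

Section Homogeneity.
Variables (n : nat) (K : fieldType).
Implicit Types f g h : {mpoly K[n]}.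

(* f(T x_1, ..., T x_n) as a polynomial in T. *)
Let grading f : {poly {mpoly K[n]}} :=
  mmap ((@polyC _) \o (@mpolyC n K)) (fun i => ('X_i)%:P * 'X) f.

Let grading_monomial f : 
  grading f = \sum_(m <- msupp f) (f@_m *: 'X_[m])%:P * 'X^(mdeg m).
Proof.
rewrite /grading /mmap; apply: eq_bigr => m _ /=.
rewrite -mul_mpolyC polyCM -mulrA; congr (_ * _).
rewrite /mmap1 mpolyXE_id rmorph_prod mdegE -prodrXr -big_split /=.
by apply: eq_bigr => i _; rewrite exprMn rmorphXn.
Qed.

Let gradingM f g : grading (f * g) = grading f * grading g.
Proof. by rewrite /grading rmorphM. Qed.

Let grading_coef f i : (grading f)`_i = pihomog mdeg i f.
Proof.
rewrite grading_monomial coef_sum pihomogE [RHS]big_mkcond; apply: eq_bigr => m _.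
by rewrite coefCM coefXn eq_sym; case: eqP => _; rewrite ?mulr1 ?mulr0.
Qed.

Let grading_eval1 f : (grading f).[1] = f.
Proof.
rewrite grading_monomial horner_sum [RHS]mpolyE; apply: eq_bigr => m _.
by rewrite hornerM hornerC hornerXn expr1n mulr1.
Qed.

Let grading_homog d h : h \is d.-homog -> grading h = h%:P * 'X^d.
Proof.
move=> hd; rewrite grading_monomial -[in RHS](grading_eval1 h) grading_monomial horner_sum.
rewrite rmorph_sum /= mulr_suml big_seq [RHS]big_seq; apply: eq_bigr => m mh.
by rewrite hornerM hornerC hornerXn expr1n mulr1 (dhomog_mf hd mh).
Qed.

Lemma dhomog_factor d f g h :
  h != 0 -> h \is d.-homog -> h = f * g -> exists i, f \is i.-homog.
Proof.
move=> h0 hd hE; have gh := grading_homog hd.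
rewrite hE gradingM -hE in gh.
have [i [c cE]] := poly_monomial_factor h0 gh; exists i.
rewrite homog_piE -grading_coef cE coefCM coefXn eqxx mulr1; apply/eqP.
by rewrite -[f in RHS]grading_eval1 cE hornerM hornerC hornerXn expr1n mulr1.
Qed.

Lemma dhomog_factors d f g h : h != 0 -> h \is d.-homog -> h = f * g ->
  exists i j, [/\ f \is i.-homog, g \is j.-homog & (i + j)%N = d].
Proof.
move=> h0 hd hE; have [i fi] := dhomog_factor h0 hd hE.
have [j gj] := dhomog_factor h0 hd (etrans hE (mulrC _ _)).
exists i, j; split=> //.
by apply: (dhomog_uniq h0 _ hd); rewrite hE; apply: dhomogM.
Qed.

(** Cofactors coming from a congruence or from [generates] need not be homogeneous; this replaces
    them by their component of the right degree. *)
Lemma pihomogMr d e f g : g \is e.-homog ->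
  pihomog mdeg d (f * g) = (if (e <= d)%N then pihomog mdeg (d - e) f else 0) * g.
Proof.
move=> ge; rewrite -!grading_coef gradingM (grading_homog ge).
rewrite mulrA coefMXn coefMC ltnNge; case: leqP => //=; by rewrite mul0r.
Qed.

Lemma dhomog0_const f : f \is 0.-homog -> f = (f@_0)%:MP.
Proof.
move=> f0; apply: msize1_polyC; rewrite leqNgt; apply/negP => s.
have fn0 : f != 0 by rewrite -msize_poly_eq0 -lt0n (leq_trans _ s).
by move: s; rewrite -(mlead_deg fn0) [mdeg _](dhomog_mf f0 (mlead_supp fn0)).
Qed.

Lemma dhomog0_unit f : f \is 0.-homog -> f != 0 -> f \is a GRing.unit.
Proof.
move=> f0; rewrite (dhomog0_const f0) mpolyC_eq0 => c0.
by apply/unitrP; exists (f@_0)^-1%:MP; rewrite -!rmorphM mulVf // mulfV // rmorph1.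
Qed.

Lemma dhomog_eval d f (c : K) (v w : 'I_n -> K) : f \is d.-homog ->
  (forall i, w i = c * v i) -> f.@[w] = c ^+ d * f.@[v].
Proof.
move=> fd wE; rewrite !mevalE mulr_sumr big_seq [RHS]big_seq; apply: eq_bigr => m mf.
rewrite mulrCA; congr (_ * _).
under eq_bigr => i _ do rewrite wE exprMn.
by rewrite big_split /= prodrXr -mdegE (dhomog_mf fd mf).
Qed.

Lemma dhomog_irreducible d f : (0 < d)%N -> f != 0 -> f \is d.-homog ->
  (forall p q g h, g \is p.-homog -> h \is q.-homog -> (0 < p)%N -> (0 < q)%N ->
     (p + q = d)%N -> f <> g * h) -> irreducible_elt f.
Proof.
move=> d0 f0 fd irr; split=> //.
  apply/negP => /unitrP[g [_ fg]].
  have [i [j [fi _ ij]]] := dhomog_factors (oner_neq0 _) (dhomog1 _ _) (esym fg).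
  by have := dhomog_uniq f0 fd fi; lia.
move=> g h fE; have [i [j [gi hj ij]]] := dhomog_factors f0 fd fE.
have := f0; rewrite fE mulf_eq0 negb_or => /andP[g0 h0].
case: i gi ij => [|i] gi ij; first by left; apply: dhomog0_unit.
case: j hj ij => [|j] hj ij; first by right; apply: dhomog0_unit.
by case: (irr _ _ _ _ gi hj isT isT ij fE).
Qed.

End Homogeneity.

Lemma linear_form_eval n (K : fieldType) (f : {mpoly K[n]}) (v : 'I_n -> K) :
  f \is 1.-homog -> f.@[v] = \sum_k f@_U_(k) * v k.
Proof.
move=> f1; rewrite [in LHS](_ : f = \sum_k f@_U_(k) *: 'X_k).
  by rewrite rmorph_sum; apply: eq_bigr => k _ /=; rewrite mevalZ mevalXU.
apply/mpolyP => m; rewrite linear_sum /=.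
under eq_bigr => k _ do rewrite mcoeffZ mcoeffX.
have [/eqP/mdeg1P [i /eqP ->]|m1] := eqVneq (mdeg m) 1%N.
  rewrite (bigD1 i) //= eqxx mulr1 big1 ?addr0 // => k ki.
  by rewrite eq_mnm1 (negbTE ki) mulr0.
rewrite (dhomog_nemf_coeff f1 m1) big1 // => k _.
by case: eqP => [e|_]; [rewrite -e mdeg1 in m1 | rewrite mulr0].
Qed.

(** * Forms on the tangents of a conic *)

Lemma poly_ext (K : numDomainType) (p q : {poly K}) :
  (forall a, p.[a] = q.[a]) -> p = q.
Proof.
by move=> pq; apply/eqP; rewrite -subr_eq0; apply/eqP/mem_roots_eq0 => a;
   rewrite hornerD hornerN pq subrr.
Qed.

Lemma comp_mpoly_congr (K : comNzRingType) m n (l : {mpoly K[m]})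
    (s t : n.-tuple {mpoly K[m]}) (f : {mpoly K[n]}) :
  (forall i, exists u, tnth s i - tnth t i = l * u) ->
  exists u, (f \mPo s) - (f \mPo t) = l * u.
Proof.
move=> st; pose P (a b : {mpoly K[m]}) := exists u, a - b = l * u.
have PD a b c d : P a b -> P c d -> P (a + c) (b + d).
  by move=> [u uE] [v vE]; exists (u + v); rewrite mulrDr -uE -vE; ring.
have PM a b c d : P a b -> P c d -> P (a * c) (b * d).
  by move=> [u uE] [v vE]; exists (u * c + b * v);
     rewrite mulrDr [l * (b * v)]mulrCA mulrA -uE -vE; ring.
have P1 a : P a a by exists 0; rewrite mulr0 subrr.
rewrite -/(P _ _) !comp_mpolyE; apply: (big_ind2 P) => // k _.
rewrite -!mul_mpolyC; apply: (PM) => //; apply: (big_ind2 P) => // i _.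
by elim: (k i) => // d IHd; rewrite !exprS; apply: PM => //; apply: st.
Qed.

Section Plane.
Variables (K : numFieldType) (Q : 'M[K]_3).
Hypothesis Q_unit : Q \in unitmx.
Implicit Types (f g h : {mpoly K[3]}) (a b c : K) (n : nat).

(** The rows of [Q] are the basis of the adapted coordinates, and the forms [crd i] are dual to
    it. *)
Definition pt (x y z : K) : 'rV[K]_3 := (\row_j [:: x; y; z]`_j) *m Q.

Definition crd (i : 'I_3) : {mpoly K[3]} := \sum_k (invmx Q) k i *: 'X_k.

Local Notation xx := (crd ord0).
Local Notation yy := (crd (lift ord0 ord0)).
Local Notation zz := (crd (lift ord0 (lift ord0 ord0))).

Lemma crd_eval i (v : 'rV[K]_3) : (crd i).@[v 0] = (v *m invmx Q) 0 i.
Proof.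
rewrite rmorph_sum mxE /=; apply: eq_bigr => k _.
by rewrite mevalZ mevalXU mulrC.
Qed.

Lemma crd_homog i : crd i \is 1.-homog.
Proof. by apply: rpred_sum => k _; apply: rpredZ; rewrite dhomogX /= mdeg1. Qed.

Lemma crd_pt i x y z : (crd i).@[pt x y z 0] = [:: x; y; z]`_i.
Proof. by rewrite crd_eval mulmxK // mxE. Qed.

Lemma ptE x y z k : pt x y z 0 k = x * Q ord0 k + y * Q (lift ord0 ord0) k
   + z * Q (lift ord0 (lift ord0 ord0)) k.
Proof. by rewrite mxE !big_ord_recl big_ord0 !mxE /= addr0 addrA. Qed.

Lemma pt_crd (v : 'rV[K]_3) : v = pt (xx).@[v 0] (yy).@[v 0] (zz).@[v 0].
Proof.
rewrite /pt -[LHS](mulmxKV Q_unit); congr (_ *m Q); apply/rowP => j.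
rewrite [RHS]mxE !crd_eval; case: j => [[|[|[|j]]]] //= lt_j; congr (_ 0 _); exact: val_inj.
Qed.

Lemma pt_eq0 x y z : pt x y z = 0 -> [/\ x = 0, y = 0 & z = 0].
Proof.
move=> p0; have E i : [:: x; y; z]`_(i : 'I_3) = 0 by rewrite -crd_pt p0 crd_eval mul0mx mxE.
by split; [exact: (E ord0) | exact: (E (lift ord0 ord0)) | exact: (E ord_max)].
Qed.

(* [spt a b] is the intersection of the tangents with parameters [a] and [b]
   (the contact point if [a = b]), and [tl a] is the equation of the tangent
   with parameter [a]. *)
Definition spt a b := pt (a + b) (a * b) 1.
Definition ev f a b := f.@[spt a b 0].
Definition tl a : {mpoly K[3]} := a ^+ 2 *: zz - a *: xx + yy.

Lemma sptC a b : spt a b = spt b a.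
Proof. by rewrite /spt addrC mulrC. Qed.

Lemma evC f a b : ev f a b = ev f b a.
Proof. by rewrite /ev sptC. Qed.

Lemma ev_xx a b : ev xx a b = a + b. Proof. exact: crd_pt. Qed.
Lemma ev_yy a b : ev yy a b = a * b. Proof. exact: crd_pt. Qed.
Lemma ev_zz a b : ev zz a b = 1. Proof. exact: crd_pt. Qed.
Lemma evM f g a b : ev (f * g) a b = ev f a b * ev g a b. Proof. exact: mevalM. Qed.
Lemma evD f g a b : ev (f + g) a b = ev f a b + ev g a b. Proof. exact: mevalD. Qed.
Lemma evB f g a b : ev (f - g) a b = ev f a b - ev g a b. Proof. exact: mevalB. Qed.
Lemma evN f a b : ev (- f) a b = - ev f a b. Proof. exact: mevalN. Qed.
Lemma evZ c f a b : ev (c *: f) a b = c * ev f a b. Proof. exact: mevalZ. Qed.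
Lemma ev0 a b : ev 0 a b = 0. Proof. exact: meval0. Qed.
Lemma evC' c a b : ev c%:MP a b = c. Proof. exact: mevalC. Qed.
Lemma ev1 a b : ev 1 a b = 1. Proof. exact: meval1. Qed.
Definition evE := (ev_xx, ev_yy, ev_zz, evM, evB, evD, evN, evZ, ev0, ev1, evC').

Lemma ev_tl c a b : ev (tl c) a b = (c - a) * (c - b).
Proof. by rewrite /tl !evE; ring. Qed.

Lemma tl_homog a : tl a \is 1.-homog.
Proof. by rewrite rpredD ?rpredB ?rpredZ ?crd_homog. Qed.

(* The restriction of [f] to the tangent [a], as a polynomial in the second parameter. *)
Definition rst a f : {poly K} :=
  mmap (@polyC K) (fun k =>
    (a * Q ord0 k + Q (lift ord0 (lift ord0 ord0)) k)%:P
    + (Q ord0 k + a * Q (lift ord0 ord0) k)%:P * 'X) f.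

Lemma horner_rst a b f : (rst a f).[b] = ev f a b.
Proof.
rewrite /ev mevalE /rst /mmap horner_sum; apply: eq_bigr => m _.
rewrite hornerM hornerC; congr (_ * _); rewrite /mmap1 horner_prod.
by apply: eq_bigr => k _; rewrite horner_exp !hornerE ptE; congr (_ ^+ _); ring.
Qed.

Lemma rstM a f g : rst a (f * g) = rst a f * rst a g. Proof. exact: rmorphM. Qed.
Lemma rstB a f g : rst a (f - g) = rst a f - rst a g. Proof. exact: rmorphB. Qed.

Lemma rstD a f g : rst a (f + g) = rst a f + rst a g. Proof. exact: rmorphD. Qed.
Lemma rst0 a : rst a 0 = 0. Proof. exact: rmorph0. Qed.
Lemma rstZ a c f : rst a (c *: f) = c *: rst a f.
Proof. by rewrite -mul_mpolyC rstM {1}/rst mmapC mul_polyC. Qed.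

Lemma rst_eq0P a f : (forall b, ev f a b = 0) <-> rst a f = 0.
Proof.
split=> [f0|f0 b]; last by rewrite -horner_rst f0 horner0.
by apply: mem_roots_eq0 => b; rewrite horner_rst.
Qed.

Lemma size_rst a n f : f \is n.-homog -> (size (rst a f) <= n.+1)%N.
Proof.
move=> fn; rewrite /rst /mmap big_seq; apply: (leq_trans (size_sum _ _ _)).
apply/bigmax_leqP_seq => m mf _; rewrite -(dhomog_mf fn mf).
apply: leq_trans (size_polyMleq _ _) _.
set t := mmap1 _ m; have: (size t <= (mdeg m).+1)%N.
  rewrite /t mdegE; apply: (big_ind2 (fun (p : {poly K}) d => size p <= d.+1)%N).
  - by rewrite size_poly1.
  - move=> p d q e hp hq; apply: leq_trans (size_polyMleq _ _) _; lia.
  move=> k _; set r := (_ + _ * 'X); have r2 : (size r <= 2)%N.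
    apply: leq_trans (size_polyD _ _) _; rewrite geq_max; apply/andP; split.
      by apply: leq_trans (size_polyC_leq1 _) _.
    apply: leq_trans (size_polyMleq _ _) _; rewrite size_polyX.
    by have := size_polyC_leq1 (Q ord0 k + a * Q (lift ord0 ord0) k); lia.
  elim: (m k) => [|d IHd]; first by rewrite expr0 size_poly1.
  by rewrite exprS; apply: leq_trans (size_polyMleq _ _) _; lia.
by move=> t_le; rewrite -subn1 leq_subLR; apply: leq_add t_le; exact: size_polyC_leq1.
Qed.

Lemma rst_tl a c : rst a (tl c) = (c - a)%:P * (c%:P - 'X).
Proof.
by apply: poly_ext => b; rewrite horner_rst ev_tl hornerM !hornerE.
Qed.

Lemma rst_tl_neq0 a c : c != a -> rst a (tl c) != 0.
Proof.
move=> ca; rewrite rst_tl mulf_neq0 ?polyC_eq0 ?subr_eq0 //.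
by rewrite eq_sym -subr_eq0 polyXsubC_eq0.
Qed.

Lemma zz_neq0 : zz != 0.
Proof. by apply/eqP => z0; have := ev_zz 0 0; rewrite z0 ev0 => /eqP; rewrite eq_sym oner_eq0. Qed.

(** On the tangent [a] one has [y = a x - a^2 z], so off [z = 0] the vector is [z] times
    [spt a (x / z - a)]. *)
Lemma ev_plane f n a (v : 'rV[K]_3) : f \is n.-homog -> zz.@[v 0] != 0 ->
  (tl a).@[v 0] = 0 -> f.@[v 0] = zz.@[v 0] ^+ n * ev f a (xx.@[v 0] / zz.@[v 0] - a).
Proof.
move=> fn z0 tv; apply: dhomog_eval fn _ => k.
rewrite [in LHS](pt_crd v) !ptE.
have -> : yy.@[v 0] = a * xx.@[v 0] - a ^+ 2 * zz.@[v 0].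
  by move: tv; rewrite /tl mevalD mevalB !mevalZ => /eqP;
     rewrite addrC addr_eq0 => /eqP ->; ring.
by field.
Qed.

Lemma tl_dvd f n a : f \is n.-homog -> rst a f = 0 ->
  exists2 g, g \is n.-1.-homog & f = tl a * g.
Proof.
move=> fn f0.
(* Projection onto the tangent [a] along [pt 0 1 0], on which [tl a] takes the value 1; it is the
   identity modulo [tl a]. *)
pose s := [tuple 'X_k - tl a * (pt 0 1 0 0 k)%:MP | k < 3].
have [g0 g0E] : exists u, (f \mPo [tuple 'X_k | k < 3]) - (f \mPo s) = tl a * u.
  apply: comp_mpoly_congr => k; exists (pt 0 1 0 0 k)%:MP.
  by rewrite !tnth_mktuple; ring.
have fs0 : f \mPo s = 0.
  (* The factor [zz] disposes of the vectors with [z = 0], to which [ev_plane] does not apply. *)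
  suff: (f \mPo s) * zz = 0.
    by move=> /eqP; rewrite mulf_eq0 (negbTE zz_neq0) orbF => /eqP.
  apply: mpoly_eval_eq0 => v; rewrite mevalM comp_mpoly_meval.
  have [->|zv0] := eqVneq (zz.@[v]) 0; first by rewrite mulr0.
  pose w : 'rV[K]_3 := \row_k v k - (tl a).@[v] *: pt 0 1 0.
  have crd_w i : (crd i).@[w 0] = (crd i).@[v] - (tl a).@[v] * [:: 0; 1; 0]`_i.
    have -> : (crd i).@[v] = (crd i).@[(\row_k v k) 0].
      by apply: meval_eq => k; rewrite mxE.
    by rewrite -crd_pt !crd_eval mulmxBl -scalemxAl !mxE.
  rewrite (_ : meval _ f = f.@[w 0]); last first.
    by apply: meval_eq => k; rewrite tnth_mktuple mevalB mevalXU mevalM mevalC !mxE.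
  have zw : zz.@[w 0] = zz.@[v] by rewrite crd_w mulr0 subr0.
  have xw : xx.@[w 0] = xx.@[v] by rewrite crd_w mulr0 subr0.
  have yw : yy.@[w 0] = yy.@[v] - (tl a).@[v] by rewrite crd_w mulr1.
  rewrite (@ev_plane _ n a) //; last 1 first.
  - by rewrite {1}/tl mevalD mevalB !mevalZ zw xw yw /tl mevalD mevalB !mevalZ; ring.
  - by rewrite ((rst_eq0P a f).2 f0) mulr0 mul0r.
  - by rewrite zw.
rewrite comp_mpoly_id fs0 subr0 in g0E.
exists (if n is n'.+1 then pihomog mdeg n' g0 else 0).
  by case: n {fn} => [|n]; [exact: rpred0 | exact: pihomogP].
rewrite -[LHS](pihomog_dE fn) g0E mulrC (pihomogMr _ _ (tl_homog a)) mulrC.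
by case: n {fn} => //= n; rewrite subn1.
Qed.

Lemma rst_eq0_homog f n (s : seq K) : f \is n.-homog -> uniq s -> (n < size s)%N ->
  (forall a, a \in s -> rst a f = 0) -> f = 0.
Proof.
elim: n s f => [|n IHn] [|a s] f fn //= /andP[as_ us] ns f0.
  move: (f0 a (mem_head _ _)); rewrite (dhomog0_const fn) => /rst_eq0P /(_ 0).
  by rewrite evC' => ->; rewrite mpolyC0.
have [g gn fE] := tl_dvd fn (f0 a (mem_head _ _)).
rewrite fE (IHn s g) ?mulr0 // => b bs.
have := f0 b; rewrite inE bs orbT fE rstM => /(_ isT) /eqP.
rewrite mulf_eq0 (negbTE (rst_tl_neq0 _)) //=; first by move/eqP.
by apply: contraNneq as_ => ->.
Qed.

(** On the tangent [a], [xx - a *: zz] is the second parameter and [zz] is 1, so this is a form of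
    degree [n] lifting [p] from the tangent to the plane. *)
Definition extend a n (p : {poly K}) : {mpoly K[3]} :=
  \sum_(j < n.+1) p`_j *: ((xx - a *: zz) ^+ j * zz ^+ (n - j)).

Lemma extend_homog a n p : extend a n p \is n.-homog.
Proof.
apply: rpred_sum => j _; apply: rpredZ.
have xh : xx - a *: zz \is 1.-homog by rewrite rpredB ?rpredZ ?crd_homog.
have := dhomogM (dhomogMn j xh) (dhomogMn (n - j) (crd_homog (lift ord0 (lift ord0 ord0)))).
by rewrite !mul1n subnKC // -ltnS.
Qed.

Lemma rst_extend a n (p : {poly K}) : (size p <= n.+1)%N -> rst a (extend a n p) = p.
Proof.
move=> pn; apply: poly_ext => b; rewrite horner_rst (horner_coef_wide _ pn) /ev rmorph_sum.
apply: eq_bigr => j _ /=; rewrite -/(ev _ a b) evZ evM /ev !rmorphXn /= -!/(ev _ a b).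
by rewrite !evE expr1n !mulr1; congr (_ * _ ^+ _); ring.
Qed.

End Plane.

(** * Bezoutians *)

Section Bezoutians.
Variables (K : numFieldType) (Q : 'M[K]_3).
Hypothesis Q_unit : Q \in unitmx.
Implicit Types (f g h F G : {mpoly K[3]}) (a b c : K) (n k : nat) (A B : seq K).

Local Notation xx := (crd Q ord0).
Local Notation yy := (crd Q (lift ord0 ord0)).
Local Notation zz := (crd Q (lift ord0 (lift ord0 ord0))).
Local Notation ev := (ev Q).
Local Notation rst := (rst Q).
Local Notation tl := (tl Q).
Local Notation evE := (evE Q_unit).

Definition pol A : {poly K} := \prod_(a <- A) ('X - a%:P).

Lemma pol_cons a A : pol (a :: A) = ('X - a%:P) * pol A.
Proof. exact: big_cons. Qed.

Lemma horner_pol_cons a A b : (pol (a :: A)).[b] = (b - a) * (pol A).[b].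
Proof. by rewrite pol_cons hornerM !hornerE. Qed.

Lemma pol_eq0 A a : ((pol A).[a] == 0) = (a \in A).
Proof. by rewrite -rootE root_prod_XsubC. Qed.

Lemma pol_root A a : a \in A -> (pol A).[a] = 0.
Proof. by rewrite -pol_eq0 => /eqP. Qed.

Lemma size_pol A : size (pol A) = (size A).+1.
Proof. exact: size_prod_XsubC. Qed.

Lemma pol_neq0 A : pol A != 0.
Proof. by rewrite -size_poly_eq0 size_pol. Qed.

Lemma pol_dvd A (p : {poly K}) : uniq A -> (forall a, a \in A -> p.[a] = 0) ->
  exists q, p = q * pol A.
Proof.
move=> uA pA; apply: uniq_roots_prod_XsubC; last by rewrite uniq_rootsE.
by apply/allP => a aA; rewrite rootE pA.
Qed.

Definition vanish A f := forall a b, a \in A -> b \in A -> a != b -> ev f a b = 0.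

Lemma vanish_cons c A f : vanish (c :: A) f -> vanish A f.
Proof. by move=> v a b aA bA; apply: v; rewrite inE ?aA ?bA orbT. Qed.

Lemma vanish_tl c A f : c \notin A -> vanish A (tl c * f) -> vanish A f.
Proof.
move=> cA v a b aA bA ab; have /eqP := v a b aA bA ab.
rewrite evM ev_tl // !mulf_eq0 !subr_eq0.
have /negbTE -> : c != a by apply: contraNneq cA => ->.
have /negbTE -> : c != b by apply: contraNneq cA => ->.
by move=> /eqP.
Qed.

Lemma vanishB A f g : vanish A f -> vanish A g -> vanish A (f - g).
Proof. by move=> vf vg a b aA bA ab; rewrite evB vf // vg // subrr. Qed.

Lemma vanishM A f g : vanish A g -> vanish A (f * g).
Proof. by move=> vg a b aA bA ab; rewrite evM vg // mulr0. Qed.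

Lemma vanishZ A c f : vanish A f -> vanish A (c *: f).
Proof. by move=> vf a b aA bA ab; rewrite evZ vf // mulr0. Qed.

(* With [A(T) = pol A], these say that on the point [spt a b] (with [a <> b])
   [F = (A(a) B(b) - A(b) B(a)) / (a - b)] and [G = A(a) B(b) + A(b) B(a)]. *)
Definition bezout_even A B F G := forall a b,
  (a - b) * ev F a b + ev G a b = 2 * ((pol A).[a] * (pol B).[b]).

(* Similarly [F0] and [F1] are the Bezoutians of [A(T)] with [B(T)] and [T B(T)]. *)
Definition bezout_odd A B F0 F1 := forall a b,
  a * ev F0 a b - ev F1 a b = (pol A).[a] * (pol B).[b].

(** Exchanging [a] and [b] changes the sign of the term in [F] only, so the two identities isolate
    [F] and [G]. *)
Lemma bezout_even_vanish A B F G : bezout_even A B F G ->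
  [/\ vanish A F, vanish A G, vanish B F & vanish B G].
Proof.
move=> bFG; suff H a b : a != b -> (pol A).[a] * (pol B).[b] = 0 ->
    (pol A).[b] * (pol B).[a] = 0 -> ev F a b = 0 /\ ev G a b = 0.
  by split=> a b aX bX ab; have [] := H a b ab; rewrite ?(pol_root aX) ?(pol_root bX) ?mul0r ?mulr0.
move=> ab e1 e2; have := bFG a b; have := bFG b a.
rewrite e1 e2 mulr0 ![ev _ b a]evC => h1 h2.
have G0 : ev G a b = 0.
  have : 2 * ev G a b = 0 by rewrite -[RHS]addr0 -{1}h1 -h2; ring.
  by move/eqP; rewrite mulf_eq0 pnatr_eq0 /= => /eqP.
split=> //; move: h2; rewrite G0 addr0 => /eqP.
by rewrite mulf_eq0 subr_eq0 (negbTE ab) => /eqP.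
Qed.

Lemma bezout_odd_vanish A B F0 F1 : bezout_odd A B F0 F1 ->
  [/\ vanish A F0, vanish A F1, vanish B F0 & vanish B F1].
Proof.
move=> bF; suff H a b : a != b -> (pol A).[a] * (pol B).[b] = 0 ->
    (pol A).[b] * (pol B).[a] = 0 -> ev F0 a b = 0 /\ ev F1 a b = 0.
  by split=> a b aX bX ab; have [] := H a b ab; rewrite ?(pol_root aX) ?(pol_root bX) ?mul0r ?mulr0.
move=> ab e1 e2; have := bF a b; have := bF b a.
rewrite e1 e2 ![ev _ b a]evC => h1 h2.
have F00 : ev F0 a b = 0.
  have : (a - b) * ev F0 a b = 0 by rewrite -[RHS](subrr 0) -{1}h2 -h1; ring.
  by move/eqP; rewrite mulf_eq0 subr_eq0 (negbTE ab) => /eqP.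
by split=> //; move: h2; rewrite F00 mulr0 sub0r => /eqP; rewrite oppr_eq0 => /eqP.
Qed.

Definition generates A B F G := forall n h, h \is n.-homog ->
  vanish A h -> vanish B h -> exists u w, h = u * F + w * G.

(** [pol B] divides the restriction of [h]; the quotient, divided by [d], lifts to a form [e], and
    [h - e * F] vanishes on the tangent [c]. Here [B] lists the zeros of [F] on that tangent and may
    come from either star. *)
Lemma tangent_residual n c B F h d : F \is (size B).-homog -> h \is n.-homog ->
  uniq B -> d != 0 -> rst c F = d *: pol B -> (forall b, b \in B -> ev h c b = 0) ->
  exists e g, g \is n.-1.-homog /\ h = e * F + tl c * g.
Proof.
move=> Fk hn uB d0 Fc hB.
have [|q qE] := pol_dvd (p := rst c h) uB; first by move=> b bB; rewrite horner_rst hB.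
(* If the quotient is 0, no degree can be compared: [n] may be smaller than [size B]. *)
have [q0|q0] := eqVneq q 0.
  have [|g gn gE] := tl_dvd Q_unit (a := c) hn; first by rewrite qE q0 mul0r.
  by exists 0, g; rewrite mul0r add0r.
have sq : (size q + size B = size (rst c h))%N.
  by rewrite qE size_mul ?pol_neq0 // size_pol addnS.
have := size_rst Q_unit c hn; rewrite -sq => sz.
have q_gt0 : (0 < size q)%N by rewrite size_poly_gt0.
have kn : (size B <= n)%N by rewrite -ltnS; apply: leq_trans sz; rewrite -add1n leq_add2r.
have sq' : (size q <= (n - size B).+1)%N by rewrite -subSn // leq_subRL ?(leqW kn) 1?addnC.
pose e := extend Q c (n - size B) (d^-1 *: q).
have en : e * F \is n.-homog.
  have := dhomogM (extend_homog Q c (n - size B) (d^-1 *: q)) Fk.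
  by rewrite subnK.
have [|g gn gE] := tl_dvd Q_unit (a := c) (rpredB hn en).
  rewrite rstB rstM Fc rst_extend //; last by rewrite size_scale ?invr_eq0.
  by rewrite qE -scalerAl -scalerAr scalerA mulVf // scale1r subrr.
by exists e, g; split=> //; rewrite -gE addrC subrK.
Qed.

(** The right side of the new identity is [2 (b - c) (a F0 - F1)]: its antisymmetric part in [a] and
    [b] is [(a - b) (F1 - c F0)], and its symmetric part is [G]. For generation, [h] is reduced
    along the added tangent [c], on which the points of the new star have their second parameter in
    [B]. *)
Lemma bezout_odd_even k A B F0 F1 c
    (F := F1 - c *: F0) (G := 2 *: (yy * F0) - xx * F1 - c *: (xx * F0) + (2 * c) *: (zz * F1)) :
  size B = k -> uniq (A ++ c :: B) -> F0 \is k.-homog -> F1 \is k.-homog ->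
  bezout_odd A B F0 F1 -> generates A B F0 F1 ->
  [/\ F \is k.-homog, G \is k.+1.-homog, bezout_even A (c :: B) F G
    & generates A (c :: B) F G].
Proof.
move=> sB uAB F0k F1k bF gF.
have bFG : bezout_even A (c :: B) F G.
  move=> a b; rewrite horner_pol_cons /F /G !evE.
  transitivity (2 * (b - c) * ((pol A).[a] * (pol B).[b])); last by ring.
  by rewrite -bF; ring.
have /= [uA /andP[/norP[cA _] /andP[cB uB]]] : uniq A /\ ~~ has (mem A) (c :: B) && uniq (c :: B).
  by move: uAB; rewrite cat_uniq => /andP[].
have Fk : F \is k.-homog by rewrite rpredB ?rpredZ.
have crdM i f : f \is k.-homog -> crd Q i * f \is k.+1.-homog.
  by move=> fk; have := dhomogM (crd_homog Q i) fk; rewrite add1n.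
split=> //; first by rewrite rpredD ?rpredB ?rpredZ ?crdM.
move=> n h hn hA hB.
have [vAF vAG vBF vBG] := bezout_even_vanish bFG.
have Fc : rst c F = (- (pol A).[c]) *: pol B.
  by apply: poly_ext => b; rewrite horner_rst hornerZ mulNr -bF /F !evE; ring.
have [|||e [g [gn hE]]] := tangent_residual _ hn uB _ Fc.
- by rewrite sB.
- by rewrite oppr_eq0 pol_eq0.
- move=> b bB; apply: hB; rewrite ?mem_head //; first by rewrite inE bB orbT.
  by apply: contraNneq cB => ->.
have tgE : tl c * g = h - e * F by rewrite hE addrC addKr.
have [||u [w gE]] := gF _ _ gn.
- by apply: (vanish_tl cA); rewrite tgE; apply: vanishB => //; apply: vanishM.
- apply: (vanish_tl cB); rewrite tgE; apply: vanishB; first exact: vanish_cons hB.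
  by apply: vanishM; apply: vanish_cons vBF.
(* As [F1 = F + c F0], this puts the products of [tl c] with both old generators into the ideal of
   [F] and [G]. *)
have tF0 : tl c * F0 = 2^-1 *: (G + xx * F) - c *: (zz * F).
  have -> : G + xx * F = 2 *: (tl c * F0 + c *: (zz * F)).
    rewrite /G /F /tl expr2 -!mul_mpolyC !rmorphM /= !mpolyC_nat; ring.
  by rewrite scalerA mulVf ?pnatr_eq0 // scale1r addrK.
exists (e + u * (2^-1 *: xx - c *: zz) + w * (tl c + c *: (2^-1 *: xx - c *: zz))).
exists (2^-1 *: u + (2^-1 * c) *: w).
have -> : h = e * F + u * (tl c * F0) + w * (tl c * F + c%:MP * (tl c * F0)).
  by rewrite hE gE /F -mul_mpolyC; ring.
by rewrite tF0 -!mul_mpolyC rmorphM /=; ring.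
Qed.

(** The even identity times [(a - c) / 2], solved together with its exchange of [a] and [b], gives
    [F0] and [F1]. Now [c] joins [A], so the restriction of [F0] to the tangent [c] is proportional
    to [pol A]. *)
Lemma bezout_even_odd k A B F G c
    (F0 := 2^-1 *: (G + xx * F - (2 * c) *: (zz * F)))
    (F1 := 2^-1 *: (c *: G + 2 *: (yy * F) - c *: (xx * F))) :
  size A = k.+1 -> uniq ((c :: A) ++ B) -> F \is k.-homog -> G \is k.+1.-homog ->
  bezout_even A B F G -> generates A B F G ->
  [/\ F0 \is k.+1.-homog, F1 \is k.+1.-homog, bezout_odd (c :: A) B F0 F1
    & generates (c :: A) B F0 F1].
Proof.
move=> sA /= /andP[cAB uAB] Fk Gk bF gF.
have bF01 : bezout_odd (c :: A) B F0 F1.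
  move=> a b; rewrite horner_pol_cons /F0 /F1 !evE.
  transitivity (2^-1 * (a - c) * (2 * ((pol A).[a] * (pol B).[b]))); last first.
    by field.
  by rewrite -bF; field.
have [cA cB] : c \notin A /\ c \notin B by apply/norP; rewrite -mem_cat.
have uA : uniq A by move: uAB; rewrite cat_uniq => /andP[].
have crdM i f : f \is k.-homog -> crd Q i * f \is k.+1.-homog.
  by move=> fk; have := dhomogM (crd_homog Q i) fk; rewrite add1n.
have F0k : F0 \is k.+1.-homog by rewrite rpredZ ?rpredB ?rpredD ?rpredZ ?crdM.
split=> //; first by rewrite rpredZ ?rpredB ?rpredD ?rpredZ ?crdM.
move=> n h hn hA hB.
have [vAF vAG vBF vBG] := bezout_odd_vanish bF01.
have F0c : rst c F0 = (pol B).[c] *: pol A.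
  apply: poly_ext => b; rewrite horner_rst hornerZ [RHS]mulrC.
  transitivity (2^-1 * (2 * ((pol A).[b] * (pol B).[c]))); last by field.
  by rewrite -bF /F0 !evE ![ev _ b c]evC; ring.
have [|||e [g [gn hE]]] := tangent_residual _ hn uA _ F0c.
- by rewrite sA.
- by rewrite pol_eq0.
- move=> b bA; apply: hA; rewrite ?mem_head //; first by rewrite inE bA orbT.
  by apply: contraNneq cA => ->.
have tgE : tl c * g = h - e * F0 by rewrite hE addrC addKr.
have [||u [w gE]] := gF _ _ gn.
- apply: (vanish_tl cA); rewrite tgE; apply: vanishB; first exact: vanish_cons hA.
  by apply: vanishM; apply: vanish_cons vAF.
- by apply: (vanish_tl cB); rewrite tgE; apply: vanishB => //; apply: vanishM.
have tF : tl c * F = F1 - c *: F0.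
  have -> : F1 - c *: F0 = 2^-1 *: (2 *: (tl c * F)).
    rewrite /F0 /F1 [c *: (2^-1 *: _)]scalerA [c / 2]mulrC -[X in _ - X]scalerA -scalerBr; congr (_ *: _).
    rewrite /tl expr2 -!mul_mpolyC !rmorphM /= !mpolyC_nat; ring.
  by rewrite scalerA mulVf ?pnatr_eq0 // scale1r.
have GE : G = 2 *: F0 - xx * F + (2 * c) *: (zz * F).
  by rewrite scalerA mulfV ?pnatr_eq0 // scale1r; ring.
exists (e + w * (2 *: tl c) - c *: (u - w * (xx - (2 * c) *: zz))).
exists (u - w * (xx - (2 * c) *: zz)).
have -> : h = e * F0 + u * (tl c * F)
             + w * (2%:MP * tl c * F0 - (xx - (2 * c) *: zz) * (tl c * F)).
  by rewrite hE gE GE -!mul_mpolyC; ring.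
by rewrite tF -!mul_mpolyC !rmorphM /=; ring.
Qed.

Lemma bezout_odd_exists k A B : size A = k.+1 -> size B = k -> uniq (A ++ B) ->
  exists F0 F1, [/\ F0 \is k.-homog, F1 \is k.-homog, bezout_odd A B F0 F1
    & generates A B F0 F1].
Proof.
elim: k A B => [|k IHk] [|a A] [|b B] //= [sA] sB /andP[aAB uAB].
  (* One tangent and none give no points, so the generators must have the unit ideal; the identity
     reads [x * 1 - a = x - a]. *)
  case: A sA aAB uAB => // _ _ _; exists 1, a%:MP; split.
  - exact: dhomog1.
  - by rewrite -[_%:MP]mulr1 mul_mpolyC rpredZ ?dhomog1.
  - by move=> x y; rewrite horner_pol_cons /pol big_nil !evE !hornerE; ring.
  by move=> n h _ _ _; exists h, 0; rewrite mulr1 mul0r addr0.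
move: sB => [sB].
have uAB' : uniq (A ++ B).
  by apply: subseq_uniq uAB; apply: cat_subseq => //; apply: subseq_cons.
have [F0 [F1 [h0 h1 bF gF]]] := IHk A B sA sB uAB'.
have [Fk Gk bFG gFG] := bezout_odd_even sB uAB h0 h1 bF gF.
have [|h0' h1' bF' gF'] := bezout_even_odd sA _ Fk Gk bFG gFG (c := a).
  by rewrite /= aAB.
by eexists; eexists; split; [exact: h0'|exact: h1'|exact: bF'|exact: gF'].
Qed.

Lemma bezout_even_exists k A B : size A = k.+1 -> size B = k.+1 -> uniq (A ++ B) ->
  exists F G, [/\ F \is k.-homog, G \is k.+1.-homog, bezout_even A B F G
    & generates A B F G].
Proof.
case: B => // b B sA [sB] uAB.
have uAB' : uniq (A ++ B).
  by apply: subseq_uniq uAB; apply: cat_subseq => //; apply: subseq_cons.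
have [F0 [F1 [h0 h1 bF gF]]] := bezout_odd_exists sA sB uAB'.
have [Fk Gk bFG gFG] := bezout_odd_even sB uAB h0 h1 bF gF.
by eexists; eexists; split; [exact: Fk|exact: Gk|exact: bFG|exact: gFG].
Qed.

End Bezoutians.

(** * Irreducible members of a pencil of Bezoutians *)

Lemma dhomog_not_unit n (K : fieldType) d (f : {mpoly K[n]}) :
  (0 < d)%N -> f \is d.-homog -> f \isn't a GRing.unit.
Proof.
move=> d0 fd; apply/negP => fU; have f0 : f != 0 by apply: contraTneq fU => ->; rewrite unitr0.
have [g [_ fg]] := unitrP fU.
have [i [j [fi _ ij]]] := dhomog_factors (oner_neq0 _) (dhomog1 _ _) (esym fg).
by have := dhomog_uniq f0 fd fi; lia.
Qed.

Lemma exists_notin (K : numDomainType) (s : seq K) : exists a, a \notin s.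
Proof.
apply: NNPP => h; have sub : {subset [seq i%:R | i <- iota 0 (size s).+1] <= s}.
  by move=> a _; apply: contraT => /negP as_; case: h; exists a; apply/negP.
have u : uniq [seq i%:R : K | i <- iota 0 (size s).+1].
  by rewrite map_inj_uniq ?iota_uniq // => i j /eqP; rewrite eqr_nat => /eqP.
by have := uniq_leq_size u sub; rewrite size_map size_iota ltnn.
Qed.

(** If two equivalence relations together relate every pair, one of them does so alone. This turns a
    comparison of scalars at each point of a star into the constancy of one family of scalars. *)
Lemma const_or_const (I : Type) (V W : eqType) (u : I -> V) (v : I -> W) :
  (forall i j, u i = u j \/ v i = v j) ->
  (forall i j, u i = u j) \/ (forall i j, v i = v j).
Proof.
move=> uv; case: (classic (exists i j, u i <> u j)) => [[i [j uij]]|nu]; last first.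
  by left=> i j; apply: NNPP => uij; apply: nu; exists i, j.
right.
have vij : v i = v j by case: (uv i j).
suff vi k : v k = v i by move=> k l; rewrite !vi.
case: (uv k i) => // uki; case: (uv k j) => [ukj|->//].
by case: uij; rewrite -uki.
Qed.

Section Pencil.
Variables (K : numClosedFieldType) (Q : 'M[K]_3).
Hypothesis Q_unit : Q \in unitmx.
Implicit Types (f g h F G : {mpoly K[3]}) (a b c : K) (n k : nat) (A B : seq K).

Local Notation xx := (crd Q ord0).
Local Notation yy := (crd Q (lift ord0 ord0)).
Local Notation zz := (crd Q (lift ord0 (lift ord0 ord0))).
Local Notation ev := (ev Q).
Local Notation rst := (rst Q).
Local Notation tl := (tl Q).
Local Notation evE := (evE Q_unit).

Lemma pol_rem A a : a \in A -> pol A = ('X - a%:P) * pol (rem a A).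
Proof. by move=> aA; rewrite /pol (perm_big _ (perm_to_rem aA)) big_cons. Qed.

(** The roots of [u] and of [v] together cover [A], so the degrees leave only constants besides the
    linear factors at these roots. *)
Lemma pol_factor A (u v : {poly K}) d : uniq A -> d != 0 -> u * v = d *: pol A ->
  exists2 c, c != 0 & u = c *: pol [seq a <- A | root u a].
Proof.
move=> uA d0 uvE; pose S (w : {poly K}) := [seq a <- A | root w a].
have SE w : exists q, w = q * pol (S w).
  by apply: pol_dvd; rewrite ?filter_uniq // => a; rewrite mem_filter => /andP[/rootP].
have uv0 : u * v != 0 by rewrite uvE scaler_eq0 negb_or d0 pol_neq0.
have /andP[u0 v0] : (u != 0) && (v != 0) by rewrite -negb_or -mulf_eq0.
have [q qE] := SE u; have [r rE] := SE v.
have q0 : q != 0 by apply: contraNneq u0 => q0; rewrite qE q0 mul0r.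
have r0 : r != 0 by apply: contraNneq v0 => r0; rewrite rE r0 mul0r.
have sA : (size A <= size (S u) + size (S v))%N.
  rewrite -size_cat; apply: uniq_leq_size => // a aA.
  rewrite mem_cat !mem_filter aA !andbT -rootM uvE.
  by rewrite rootZ // rootE pol_root.
have : size (u * v) = (size A).+1 by rewrite uvE size_scale // size_pol.
rewrite {1}qE {1}rE mulrACA size_mul ?mulf_neq0 ?pol_neq0 // !size_mul ?pol_neq0 // !size_pol.
move=> sE; have : (size q == 1)%N.
  have : (0 < size q)%N by rewrite size_poly_gt0.
  have : (0 < size r)%N by rewrite size_poly_gt0.
  by move: sA sE; move: (size q) (size r) (size A) (size (S u)) (size (S v)); lia.
by move=> /size_poly1P[c c0 cE]; exists c; rewrite // -mul_polyC -cE.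
Qed.

Lemma pol_factor_root A (u v : {poly K}) d a : uniq A -> d != 0 ->
  u * v = d *: pol A -> a \in A -> u.[a] = 0 -> v.[a] != 0.
Proof.
move=> uA d0 uvE aA /eqP/factor_theorem[q qE]; apply/eqP => /eqP/factor_theorem[r rE].
have X0 : 'X - a%:P != 0 :> {poly K} by rewrite polyXsubC_eq0.
have : q * r * ('X - a%:P) = d *: pol (rem a A).
  apply: (mulIf X0); rewrite -scalerAl [pol _ * _]mulrC -(pol_rem aA) -uvE qE rE.
  by ring.
move=> /(congr1 (fun p : {poly K} => p.[a])) /eqP.
rewrite hornerM hornerXsubC subrr mulr0 hornerZ eq_sym mulf_eq0 (negbTE d0) /=.
by rewrite pol_eq0 mem_rem_uniq // !inE eqxx.
Qed.

(** The restriction of [f] to the tangent [c] has the full degree of [f], hence each factor keeps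
    its degree too; a factor of positive degree then has a zero on the tangent, [K] being
    algebraically closed. *)
Lemma common_factor_unit c d B f h g : d != 0 -> f \is (size B).-homog ->
  rst c f = d *: pol B -> f = h * g -> (forall b, ev h c b != 0) ->
  h \is a GRing.unit.
Proof.
move=> d0 fB fE fhg h0.
have rf0 : rst c f != 0 by rewrite fE scaler_eq0 negb_or d0 pol_neq0.
have f0 : f != 0 by apply: contraNneq rf0 => ->; rewrite rst0.
have [i [j [hi gj ij]]] := dhomog_factors f0 fB fhg.
have hn0 : h != 0 by apply: contraNneq f0 => z; rewrite fhg z mul0r.
case: i hi ij => [|i] hi ij; first exact: dhomog0_unit.
have : size (rst c f) = (size B).+1 by rewrite fE size_scale // size_pol.
move: rf0; rewrite fhg rstM mulf_eq0 negb_or => /andP[rh0 rg0].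
rewrite size_mul // => sE.
have := size_rst Q_unit c hi; have := size_rst Q_unit c gj => sg sh.
have /closed_rootP [b] : size (rst c h) != 1%N.
  apply/eqP => s1; rewrite s1 /= in sE.
  by move: sE sg ij; move: (size (rst c g)) (size B); lia.
by rewrite rootE horner_rst (negbTE (h0 b)).
Qed.

(** On a tangent [c] outside both sets, a common zero with parameter [b] makes [A(c) B(b)] and
    [A(b) B(c)] vanish, so [b] would be a root of both [A] and [B]. *)
Lemma bezout_odd_coprime A B F0 F1 : uniq (A ++ B) ->
  F0 \is (size B).-homog -> F1 \is (size B).-homog -> bezout_odd Q A B F0 F1 ->
  no_common_component F0 F1.
Proof.
rewrite cat_uniq => /and3P[_ /hasPn AB _] F0k F1k bF h [f0 F0E] [f1 F1E].
have [c] := exists_notin (A ++ B); rewrite mem_cat => /norP[cA cB].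
apply: (@common_factor_unit c (pol A).[c] B (c *: F0 - F1) h (c *: f0 - f1)).
- by rewrite pol_eq0.
- by rewrite rpredB ?rpredZ.
- by apply: poly_ext => b; rewrite horner_rst hornerZ -bF !evE.
- by rewrite F0E F1E mulrBr scalerAr.
move=> b; apply/eqP => hb; have := bF c b; have := bF b c.
rewrite ![ev _ b c]evC F0E F1E !evE hb !mul0r !mulr0 subrr => /esym/eqP + /esym/eqP.
rewrite !mulf_eq0 !pol_eq0 (negbTE cA) (negbTE cB) orbF /= => bA bB.
by have := AB b bB; rewrite /= bA.
Qed.

Lemma bezout_even_coprime A B F G : uniq (A ++ B) -> (0 < size B)%N ->
  F \is (size B).-1.-homog -> G \is (size B).-homog -> bezout_even Q A B F G ->
  no_common_component F G.
Proof.
rewrite cat_uniq => /and3P[_ /hasPn AB _] B0 Fk Gk bF h [f FE] [g GE].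
have [c] := exists_notin (A ++ B); rewrite mem_cat => /norP[cA cB].
(* This linear form is [c - b] at [spt c b], so the combination below restricts to the left side of
   [bezout_even]. *)
have cz : (2 * c) *: zz - xx \is 1.-homog by rewrite rpredB ?rpredZ ?crd_homog.
apply: (@common_factor_unit c (2 * (pol A).[c]) B (((2 * c) *: zz - xx) * F + G) h
          (((2 * c) *: zz - xx) * f + g)).
- by rewrite mulf_eq0 pnatr_eq0 pol_eq0.
- by rewrite rpredD //; have := dhomogM cz Fk; rewrite add1n prednK.
- by apply: poly_ext => b; rewrite horner_rst hornerZ -mulrA -bF !evE; ring.
- by rewrite FE GE; ring.
move=> b; apply/eqP => hb; have := bF c b; have := bF b c.
rewrite ![ev _ b c]evC FE GE !evE hb !mul0r !mulr0 addr0 => /esym/eqP + /esym/eqP.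
rewrite !mulf_eq0 !pol_eq0 pnatr_eq0 (negbTE cA) (negbTE cB) orbF /= => bA bB.
by have := AB b bB; rewrite /= bA.
Qed.

(** On a tangent [a] of [A], [F1 - t F0] is [a - t] times [F0], so the members with [t] different
    from [a] have the same zeros there. *)
Lemma bezout_odd_rst A B F0 F1 a : a \in A -> bezout_odd Q A B F0 F1 ->
  rst a F1 = a *: rst a F0 /\ rst a F0 = (pol B).[a] *: pol (rem a A).
Proof.
move=> aA bF; have F1E b : ev F1 a b = a * ev F0 a b.
  by apply/eqP; rewrite eq_sym -subr_eq0 bF pol_root ?mul0r.
split; first by apply: poly_ext => b; rewrite hornerZ !horner_rst.
have X0 : 'X - a%:P != 0 :> {poly K} by rewrite polyXsubC_eq0.
apply: (mulfI X0); rewrite -scalerAr -pol_rem //; apply: poly_ext => b.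
rewrite hornerM hornerXsubC hornerZ horner_rst [RHS]mulrC -bF ![ev _ b a]evC F1E.
by ring.
Qed.

(* If two members [U V] and [U' V'] of the pencil vanish in the same way on the star of
   [A], then on each tangent [a] in [A] they agree up to scalars [c a], [d a];
   two of these tangents meet off [U = 0] or off [V = 0], so [c] or [d] is constant. *)
Lemma pencil_factors_unique k A B F0 F1 t t' p q (U V U' V' : {mpoly K[3]}) :
  size A = k.+1 -> size B = k -> uniq (A ++ B) ->
  F0 \is k.-homog -> F1 \is k.-homog -> bezout_odd Q A B F0 F1 ->
  t \notin A -> t' \notin A -> (0 < p)%N -> (0 < q)%N -> (p + q = k)%N ->
  U \is p.-homog -> V \is q.-homog -> U' \is p.-homog -> V' \is q.-homog ->
  F1 - t *: F0 = U * V -> F1 - t' *: F0 = U' * V' ->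
  (forall i j : 'I_k.+1, (ev U A`_i A`_j == 0) = (ev U' A`_i A`_j == 0)) ->
  (forall i j : 'I_k.+1, (ev V A`_i A`_j == 0) = (ev V' A`_i A`_j == 0)) ->
  t = t'.
Proof.
move=> sA sB uAB F0k F1k bF tA t'A p0 q0 pq Up Vq U'p V'q UV UV' EU EV.
have uA : uniq A by move: uAB; rewrite cat_uniq => /andP[].
have AB a : a \in A -> (pol B).[a] != 0.
  move=> aA; rewrite pol_eq0; apply/negP => aB.
  by move: uAB; rewrite cat_uniq => /and3P[_ /hasPn /(_ a aB)]; rewrite /= aA.
have inA (i : 'I_k.+1) : A`_i \in A by rewrite mem_nth ?sA.
have rstE s u v (i : 'I_k.+1) : F1 - s *: F0 = u * v ->
    rst A`_i u * rst A`_i v = ((A`_i - s) * (pol B).[A`_i]) *: pol (rem A`_i A).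
  move=> uv; rewrite -rstM -uv; have [e1 e0] := bezout_odd_rst (inA i) bF.
  rewrite rstB e1 rstZ -scalerBl e0 scalerA.
  by [].
have nz s (i : 'I_k.+1) : s \notin A -> (A`_i - s) * (pol B).[A`_i] != 0.
  by move=> sA'; rewrite mulf_neq0 ?AB // subr_eq0; apply: contraNneq sA' => <-.
have urem (i : 'I_k.+1) : uniq (rem (A`_i) A) by rewrite rem_uniq.
have prop f g f' g' : F1 - t *: F0 = f * g -> F1 - t' *: F0 = f' * g' ->
    (forall i j : 'I_k.+1, (ev f A`_i A`_j == 0) = (ev f' A`_i A`_j == 0)) ->
    exists c : 'I_k.+1 -> K, forall i : 'I_k.+1, rst A`_i f = c i *: rst A`_i f'.
  move=> fg fg' E.
  apply: (@fin_all_exists _ (fun=> K) (fun (i : 'I_k.+1) c => rst A`_i f = c *: rst A`_i f')) => i.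
  have [c c0 cE] := pol_factor (urem i) (nz _ i tA) (rstE _ _ _ i fg).
  have [c' c0' cE'] := pol_factor (urem i) (nz _ i t'A) (rstE _ _ _ i fg').
  exists (c / c'); rewrite cE cE' scalerA divfK //; congr (_ *: pol _).
  apply: eq_in_filter => a /mem_rem aA.
  have ai : (index a A < k.+1)%N by rewrite -sA index_mem.
  by rewrite !rootE !horner_rst; have := E i (Ordinal ai); rewrite /= nth_index.
have [c cE] := prop _ _ _ _ UV UV' EU.
have [d dE] : exists d : 'I_k.+1 -> K, forall i : 'I_k.+1, rst A`_i V = d i *: rst A`_i V'.
  by apply: (prop _ U _ U') => //; rewrite mulrC.
have nt f f' (e : 'I_k.+1 -> K) (i j : 'I_k.+1) :
    (forall i : 'I_k.+1, rst A`_i f = e i *: rst A`_i f') ->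
    ev f' A`_i A`_j != 0 -> e i = e j.
  move=> eE nz'; apply: (mulIf nz').
  have E l m : ev f A`_(l : 'I_k.+1) A`_(m : 'I_k.+1) = e l * ev f' A`_l A`_m.
    by rewrite -!horner_rst eE hornerZ.
  by rewrite -E evC E evC.
have cd (i j : 'I_k.+1) : c i = c j \/ d i = d j.
  have [->|ij] := eqVneq i j; first by left.
  have [U0|U0] := eqVneq (ev U' A`_i A`_j) 0; last by left; apply: nt cE U0.
  (* The zeros of the member on this tangent are simple, so [U'] and [V'] do not both vanish at the
     point. *)
  right; apply: nt dE _; rewrite -horner_rst.
  apply: (pol_factor_root (urem i) (nz _ i t'A) (rstE _ _ _ i UV')).
    by rewrite mem_rem_uniq // !inE inA nth_uniq ?sA // eq_sym ij.
  by rewrite horner_rst.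
have cop f g f' g' e m : F1 - t *: F0 = f * g -> F1 - t' *: F0 = f' * g' ->
    (0 < m)%N -> (m < k.+1)%N -> f \is m.-homog -> f' \is m.-homog ->
    (forall i : 'I_k.+1, rst A`_i f = e *: rst A`_i f') -> t = t'.
  move=> fg fg' m0 mk fm f'm ee.
  (* The difference has degree [m < k + 1] and vanishes on [k + 1] tangents. *)
  have fE : f = e *: f'.
    apply/eqP; rewrite -subr_eq0; apply/eqP.
    apply: (rst_eq0_homog Q_unit (n := m) (s := A)) => //; rewrite ?sA ?rpredB ?rpredZ //.
    move=> a aA; have ai : (index a A < k.+1)%N by rewrite -sA index_mem.
    have := ee (Ordinal ai); rewrite /= nth_index // => fe.
    by rewrite rstB fe rstZ subrr.
  apply/eqP/negPn/negP => tt; have /negP := dhomog_not_unit m0 f'm; apply.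
  rewrite -subr_eq0 in tt.
  (* The two members differ by a nonzero multiple of [F0], so [f'] divides [F0] and then [F1]. *)
  have F0E : F0 = f' * ((t - t')^-1 *: (g' - e *: g)).
    rewrite -scalerAr mulrBr -fg' -scalerAr scalerAl -fE -fg.
    have -> : F1 - t' *: F0 - (F1 - t *: F0) = (t - t') *: F0 by rewrite scalerBl; ring.
    by rewrite scalerA mulVf // scale1r.
  have cp := bezout_odd_coprime uAB _ _ bF; rewrite sB in cp; apply: (cp F0k F1k).
    by eexists; exact: F0E.
  exists (g' + t' *: ((t - t')^-1 *: (g' - e *: g))).
  by rewrite mulrDr -fg' -scalerAr -F0E subrK.
have [pk qk] : (p < k.+1)%N /\ (q < k.+1)%N by rewrite -pq !ltnS leq_addr leq_addl.
case: (const_or_const cd) => const.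
  apply: (cop _ _ _ _ (c ord0) p UV UV' p0 pk Up U'p) => i.
  by rewrite cE (const i ord0).
rewrite mulrC in UV; rewrite mulrC in UV'.
apply: (cop _ _ _ _ (d ord0) q UV UV' q0 qk Vq V'q) => i.
by rewrite dE (const i ord0).
Qed.

Lemma bezout_pencil_irreducible k A B F0 F1 :
  size A = k.+1 -> size B = k -> uniq (A ++ B) -> (0 < k)%N ->
  F0 \is k.-homog -> F1 \is k.-homog -> bezout_odd Q A B F0 F1 ->
  exists bad : seq K, forall t, t \notin bad -> irreducible_elt (F1 - t *: F0).
Proof.
move=> sA sB uAB k0 F0k F1k bF.
(* The type of a factorisation: the degree of the first factor and the points of the star of [A] at
   which each factor vanishes. Each of the finitely many types occurs for at most one parameter
   outside [A]. *)
pose T := ('I_k.+1 * {ffun 'I_k.+1 * 'I_k.+1 -> bool} * {ffun 'I_k.+1 * 'I_k.+1 -> bool})%type.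
pose D f : {ffun 'I_k.+1 * 'I_k.+1 -> bool} :=
  [ffun ij : 'I_k.+1 * 'I_k.+1 => ev f A`_(ij.1) A`_(ij.2) == 0].
pose red t (c : T) := t \notin A /\ exists p q U V,
  [/\ F1 - t *: F0 = U * V, U \is p.-homog, V \is q.-homog, (0 < p)%N & (0 < q)%N] /\
  [/\ (p + q = k)%N, p = c.1.1 :> nat, D U = c.1.2 & D V = c.2].
have /fin_all_exists [bad badP] (c : T) : exists t0, forall t, red t c -> t = t0.
  case: (classic (exists t0, red t0 c)) => [[t0 r0]|nr]; last first.
    by exists 0 => t rt; case: nr; exists t.
  exists t0 => t; case: r0 => t0A [p [q [U [V [[UV Up Vq p0 q0] [pq pT DU DV]]]]]].
  case=> tA [p' [q' [U' [V' [[UV' Up' Vq' _ _] [pq' pT' DU' DV']]]]]].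
  have epp : p' = p by rewrite pT pT'.
  have eqq : q' = q by apply: (@addnI p); rewrite pq -[in LHS]epp.
  rewrite {}epp {p' pT' pq'} in Up' *; rewrite {}eqq in Vq'.
  apply: (pencil_factors_unique sA sB uAB F0k F1k bF tA t0A p0 q0 pq Up' Vq' Up Vq UV' UV).
    by move=> i j; have /ffunP /(_ (i, j)) := etrans DU' (esym DU); rewrite !ffunE.
  by move=> i j; have /ffunP /(_ (i, j)) := etrans DV' (esym DV); rewrite !ffunE.
(* The parameters in [A] are discarded as well: for them the member vanishes on a whole tangent. *)
exists (A ++ codom bad) => t; rewrite mem_cat => /norP[tA tbad].
have inA : A`_0 \in A by rewrite mem_nth ?sA.
apply: (dhomog_irreducible k0); last 1 first.
- move=> p q U V Up Vq p0 q0 pq UV.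
  have pk : (p < k.+1)%N by rewrite -pq ltnS leq_addr.
  case/negP: tbad; rewrite (badP (Ordinal pk, D U, D V) t) ?codom_f //.
  by split=> //; exists p, q, U, V.
- apply/eqP => M0; have [e1 e0] := bezout_odd_rst inA bF.
  have : rst A`_0 (F1 - t *: F0) = 0 by rewrite M0 rst0.
  rewrite rstB e1 rstZ -scalerBl e0 scalerA => /eqP.
  rewrite scaler_eq0 (negbTE (pol_neq0 _)) orbF mulf_eq0 subr_eq0 pol_eq0.
  case/orP=> [/eqP At|AB]; first by rewrite -At inA in tA.
  by move: uAB; rewrite cat_uniq => /and3P[_ /hasPn /(_ _ AB)]; rewrite /= inA.
- by rewrite rpredB ?rpredZ.
Qed.

End Pencil.

(** * Openness of irreducibility *)

Section PolynomialFunctions.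
Variables (K : fieldType) (V : vectType K).
Implicit Types (f g : V -> K).

Definition polyfun f := exists P : {mpoly K[\dim {:V}]},
  forall v, f v = P.@[fun i => coord (vbasis {:V}) i v].

Lemma polyfun_ext f g : f =1 g -> polyfun f -> polyfun g.
Proof. by move=> fg [P PE]; exists P => v; rewrite -fg. Qed.

Lemma polyfun_const c : polyfun (fun=> c).
Proof. by exists c%:MP => v; rewrite mevalC. Qed.

Lemma polyfunD f g : polyfun f -> polyfun g -> polyfun (fun v => f v + g v).
Proof. by move=> [P PE] [R RE]; exists (P + R) => v; rewrite mevalD PE RE. Qed.

Lemma polyfunM f g : polyfun f -> polyfun g -> polyfun (fun v => f v * g v).
Proof. by move=> [P PE] [R RE]; exists (P * R) => v; rewrite mevalM PE RE. Qed.

Lemma polyfunZ c f : polyfun f -> polyfun (fun v => c * f v).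
Proof. exact: polyfunM (polyfun_const c). Qed.

Lemma polyfunB f g : polyfun f -> polyfun g -> polyfun (fun v => f v - g v).
Proof.
move=> pf pg; apply: polyfun_ext (polyfunD pf (polyfunZ (-1) pg)) => v.
by rewrite mulN1r.
Qed.

Lemma polyfun_coord n (X : n.-tuple V) i : polyfun (coord X i).
Proof.
exists (\sum_(j < \dim {:V}) coord X i (vbasis {:V})`_j *: 'X_j) => v.
rewrite {1}(coord_vbasis (memvf v)) linear_sum rmorph_sum; apply: eq_bigr => j _ /=.
by rewrite linearZ mevalZ mevalXU mulrC.
Qed.

Lemma polyfun_sum (I : Type) (r : seq I) (P : pred I) (F : I -> V -> K) :
  (forall i, P i -> polyfun (F i)) -> polyfun (fun v => \sum_(i <- r | P i) F i v).
Proof.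
move=> pF; elim: r => [|i r IHr].
  by apply: polyfun_ext (polyfun_const 0) => v; rewrite big_nil.
case Pi: (P i); last by apply: polyfun_ext IHr => v; rewrite big_cons Pi.
by apply: polyfun_ext (polyfunD (pF i Pi) IHr) => v; rewrite big_cons Pi.
Qed.

Lemma polyfun_prod (I : Type) (r : seq I) (P : pred I) (F : I -> V -> K) :
  (forall i, P i -> polyfun (F i)) -> polyfun (fun v => \prod_(i <- r | P i) F i v).
Proof.
move=> pF; elim: r => [|i r IHr].
  by apply: polyfun_ext (polyfun_const 1) => v; rewrite big_nil.
case Pi: (P i); last by apply: polyfun_ext IHr => v; rewrite big_cons Pi.
by apply: polyfun_ext (polyfunM (pF i Pi) IHr) => v; rewrite big_cons Pi.
Qed.

Lemma polyfun_meval n (P : {mpoly K[n]}) (F : 'I_n -> V -> K) :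
  (forall i, polyfun (F i)) -> polyfun (fun v => P.@[F^~ v]).
Proof.
move=> pF; apply: (@polyfun_ext (fun v => \sum_(m <- msupp P) P@_m * \prod_i F i v ^+ m i)).
  by move=> v; rewrite mevalE.
apply: polyfun_sum => m _; apply: polyfunZ; apply: polyfun_prod => i _.
elim: (m i) => [|d IHd]; first exact: polyfun_const.
by apply: polyfun_ext (polyfunM (pF i) IHd) => v; rewrite exprS.
Qed.

Lemma polyfun_det n (A : V -> 'M[K]_n) :
  (forall i j, polyfun (fun v => A v i j)) -> polyfun (fun v => \det (A v)).
Proof.
by move=> pA; apply: polyfun_sum => s _; apply: polyfunZ; apply: polyfun_prod.
Qed.

Lemma general_in_polyfun (W P : V -> Prop) f : polyfun f ->
  (exists v, W v /\ f v != 0) -> (forall v, W v -> f v != 0 -> P v) -> general_in W P.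
Proof.
move=> [p pE] exW WP; exists (fun v => f v != 0); split=> //.
exists (fun r => r = p) => v; rewrite pE; split=> [|[r ->] //].
by exists p.
Qed.

End PolynomialFunctions.

Section FactorizationOpen.
Variables (K : fieldType) (V : vectType K) (T : finType) (P : T -> V -> 'rV[K]_3).
Hypothesis polyP : forall g k, polyfun (fun v => P g v 0 k).

(** The hypothesis says that the matrix [L v0] of the values of a basis of forms has independent
    rows. The determinant of [L v] times a right inverse of [L v0] is 1 at [v0], and where it is
    nonzero the rows of [L v] are independent. *)
Lemma vanishing_open p (S : {set T}) v0 :
  (forall U : {mpoly K[3]}, U \is p.-homog ->
     (forall g, g \in S -> U.@[P g v0 0] = 0) -> U = 0) ->
  exists f, [/\ polyfun f, f v0 != 0 & forall v, f v != 0 ->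
    forall U : {mpoly K[3]}, U \is p.-homog ->
      (forall g, g \in S -> U.@[P g v 0] = 0) -> U = 0].
Proof.
move=> inj0; pose E := vbasis {: dhomog 3 K p}.
(* Columns outside [S] are filled with zeros, so that the shape of the matrix does not depend on
   [S]. *)
pose L v : 'M[K]_(\dim {: dhomog 3 K p}, #|T|) := \matrix_(i, j)
  if enum_val j \in S then (mpoly_of_dhomog E`_i).@[P (enum_val j) v 0] else 0.
have evalE (u : 'rV_(\dim {: dhomog 3 K p})) (U : dhomog 3 K p) v j :
    U = \sum_i u 0 i *: E`_i -> enum_val j \in S ->
    (u *m L v) 0 j = (mpoly_of_dhomog U).@[P (enum_val j) v 0].
  move=> -> jS; rewrite mxE !linear_sum /=; apply: eq_bigr => i _.
  by rewrite mxE jS; apply: (esym (mevalZ _ _ _)).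
have L0 : row_free (L v0).
  apply: inj_row_free => u uL; pose U := \sum_i u 0 i *: E`_i.
  have U0 : U = 0.
    apply: val_inj; apply: inj0 => [|g gS]; first exact: dhomog_is_dhomog.
    have := evalE u U v0 (enum_rank g) erefl; rewrite enum_rankK => /(_ gS) <-.
    by rewrite uL mxE.
  apply/rowP => i; rewrite mxE -(coord_sum_free (u 0) i (basis_free (vbasisP _))) -/E.
  by rewrite -/U U0 linear0.
exists (fun v => \det (L v *m pinvmx (L v0))); split.
- apply: polyfun_det => i j; apply: (@polyfun_ext _ _ (fun v =>
      \sum_k L v i k * pinvmx (L v0) k j)).
    by move=> v; rewrite [RHS]mxE.
  apply: polyfun_sum => k _; apply: polyfunM (polyfun_const _ _).
  apply: (@polyfun_ext _ _ (fun v => if enum_val k \in S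
      then (mpoly_of_dhomog E`_i).@[P (enum_val k) v 0] else 0)).
    by move=> v; rewrite mxE.
  by case: (enum_val k \in S); [apply: polyfun_meval => l; apply: polyP | apply: polyfun_const].
- by rewrite mulmxVp // det1 oner_eq0.
move=> v dv U Up Uv; pose U' : dhomog 3 K p := DHomog Up.
pose u : 'rV_(\dim {: dhomog 3 K p}) := \row_i coord E i U'.
have UE : U' = \sum_i u 0 i *: E`_i.
  by rewrite {1}(coord_vbasis (memvf U')); apply: eq_bigr => i _; rewrite mxE.
have uL : u *m L v = 0.
  apply/rowP => j; case jS: (enum_val j \in S).
    by rewrite (evalE _ U') //= Uv // mxE.
  by rewrite !mxE big1 // => i _; rewrite [L v i j]mxE jS mulr0.
have u0 : u = 0.
  have Lu : L v *m pinvmx (L v0) \in unitmx by rewrite unitmxE unitfE.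
  by rewrite -(mulmxK Lu u) mulmxA uL !mul0mx.
rewrite -[U]/(mpoly_of_dhomog U') UE u0 big1 ?linear0 // => i _.
by rewrite mxE scale0r.
Qed.

(* A factorisation of a form vanishing at the points [P g v] distributes these points among
   the two factors; for each distribution, the existence of such factors is a closed condition. *)
Lemma irreducible_open n v0 : (0 < n)%N ->
  (forall p q (U W : {mpoly K[3]}), (0 < p)%N -> (0 < q)%N -> (p + q = n)%N ->
     U \is p.-homog -> W \is q.-homog ->
     (forall g, (U * W).@[P g v0 0] = 0) -> U * W = 0) ->
  exists f, [/\ polyfun f, f v0 != 0 & forall v (M : {mpoly K[3]}), f v != 0 ->
    M != 0 -> M \is n.-homog -> (forall g, M.@[P g v 0] = 0) -> irreducible_elt M].
Proof.
move=> n0 irr0; pose I := ('I_n * {set T})%type.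
pose none (v : V) p (S : {set T}) := forall U : {mpoly K[3]}, U \is p.-homog ->
  (forall g, g \in S -> U.@[P g v 0] = 0) -> U = 0.
have open1 (pS : I) : exists f, [/\ polyfun f, f v0 != 0 & (0 < pS.1)%N ->
    forall v, f v != 0 -> none v pS.1 pS.2 \/ none v (n - pS.1)%N (~: pS.2)].
  case: pS => [[p pn] S] /=.
  have [p0|p0] := posnP p.
    by exists (fun=> 1); rewrite oner_eq0 p0; split=> //; apply: polyfun_const.
  have [h|h] := classic (none v0 p S).
    by have [f [pf f0 fv]] := vanishing_open h; exists f; split=> // _ v /fv; left.
  suff h' : none v0 (n - p)%N (~: S).
    by have [f [pf f0 fv]] := vanishing_open h'; exists f; split=> // _ v /fv; right.
  (* Nonzero forms on both sides of the distribution would have a nonzero product vanishing at all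
     the points. *)
  move=> W Wq W0; apply: NNPP => Wn; apply: h => U Up U0.
  have : U * W = 0.
    apply: (irr0 p (n - p)%N) => //; try lia.
    move=> g; rewrite mevalM; case gS: (g \in S); first by rewrite U0 ?mul0r.
    by rewrite W0 ?mulr0 // inE gS.
  by move/eqP; rewrite mulf_eq0 => /orP[] /eqP.
have [F FP] : exists F : I -> V -> K, forall i, [/\ polyfun (F i), F i v0 != 0 &
    (0 < i.1)%N -> forall v, F i v != 0 -> none v i.1 i.2 \/ none v (n - i.1)%N (~: i.2)].
  exact: fin_all_exists open1.
exists (fun v => \prod_i F i v); split.
- by apply: polyfun_prod => i _; have [] := FP i.
- by apply/prodf_neq0 => i _; have [] := FP i.
move=> v M /prodf_neq0 Fv M0 Mn MP; apply: (dhomog_irreducible n0 M0 Mn).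
move=> p q U W Up Wq p0 q0 pq MUW; have pn : (p < n)%N by lia.
pose S := [set g | U.@[P g v 0] == 0].
have [_ _ /(_ p0 v (Fv _ isT)) /=] := FP (Ordinal pn, S).
have -> : (n - p = q)%N by lia.
move=> noUW; move/eqP: M0; apply; rewrite MUW; case: noUW => [noU|noW].
  by rewrite (noU U) ?mul0r // => g; rewrite inE => /eqP.
rewrite (noW W) ?mulr0 // => g; rewrite !inE => /negbTE Ug.
by have /eqP := MP g; rewrite MUW mevalM mulf_eq0 Ug => /eqP.
Qed.

End FactorizationOpen.

Lemma irreducible_unitM (R : idomainType) (u a : R) :
  u \is a GRing.unit -> irreducible_elt a -> irreducible_elt (u * a).
Proof.
move=> uU [a0 aU a_irr]; split.
- by rewrite mulf_neq0 //; apply: contraTneq uU => ->; rewrite unitr0.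
- by rewrite unitrMr.
move=> b c ua; have [] := a_irr (u^-1 * b) c; first by rewrite -mulrA -ua mulKr.
  by rewrite unitrMr ?unitrV //; left.
by right.
Qed.

Lemma irreducible_scale n (K : fieldType) c (f : {mpoly K[n]}) :
  c != 0 -> irreducible_elt f -> irreducible_elt (c *: f).
Proof.
move=> c0; rewrite -mul_mpolyC; apply: irreducible_unitM.
by apply/unitrP; exists c^-1%:MP; rewrite -!rmorphM mulVf // mulfV // rmorph1.
Qed.

(** * General members of the linear systems through two stars *)

Section General.
Variables (K : numClosedFieldType) (Q : 'M[K]_3).
Hypothesis Q_unit : Q \in unitmx.
Implicit Types (f g h F G : {mpoly K[3]}) (a b c : K) (n k : nat) (A B : seq K).

Local Notation xx := (crd Q ord0).
Local Notation yy := (crd Q (lift ord0 ord0)).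
Local Notation zz := (crd Q (lift ord0 (lift ord0 ord0))).
Local Notation ev := (ev Q).
Local Notation rst := (rst Q).
Local Notation evE := (evE Q_unit).

Lemma linear_form f : f \is 1.-homog ->
  exists c0 c1 c2, f = c0 *: xx + c1 *: yy + c2 *: zz.
Proof.
move=> f1; pose c i := \sum_k f@_U_(k) * Q i k.
exists (c ord0), (c (lift ord0 ord0)), (c (lift ord0 (lift ord0 ord0))).
apply/eqP; rewrite -subr_eq0; apply/eqP/mpoly_eval_eq0 => v.
pose w : 'rV[K]_3 := \row_k v k.
have vE p : p.@[v] = p.@[w 0] by apply: meval_eq => k; rewrite mxE.
rewrite vE mevalB !mevalD !mevalZ (linear_form_eval _ f1); apply/eqP; rewrite subr_eq0; apply/eqP.
have wE (k : 'I_3) : w 0 k = xx.@[w 0] * Q ord0 k + yy.@[w 0] * Q (lift ord0 ord0) k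
    + zz.@[w 0] * Q (lift ord0 (lift ord0 ord0)) k.
  by rewrite -ptE -(pt_crd Q_unit).
under eq_bigr => i _ do rewrite wE !mulrDr.
rewrite !big_split /= /c !mulr_suml; congr (_ + _ + _); apply: eq_bigr => k _; ring.
Qed.

Lemma generates_odd A B F0 F1 k h : F0 \is k.-homog -> F1 \is k.-homog ->
  generates Q A B F0 F1 -> h \is k.-homog -> vanish Q A h -> vanish Q B h ->
  exists c1 c0, h = c1 *: F1 + c0 *: F0.
Proof.
move=> F0k F1k gF hk hA hB; have [u [w hE]] := gF k h hk hA hB.
exists (pihomog mdeg 0 w)@_0, (pihomog mdeg 0 u)@_0.
rewrite -!mul_mpolyC -!(dhomog0_const (pihomogP mdeg 0 _)) addrC.
rewrite -[LHS](pihomog_dE hk) hE pihomogD (pihomogMr _ _ F0k) (pihomogMr _ _ F1k).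
by rewrite leqnn subnn.
Qed.

Lemma generates_even A B F G k h : F \is k.-homog -> G \is k.+1.-homog ->
  generates Q A B F G -> h \is k.+1.-homog -> vanish Q A h -> vanish Q B h ->
  exists c0 c1 c2 c3, h = (c0 *: xx + c1 *: yy + c2 *: zz) * F + c3 *: G.
Proof.
move=> Fk Gk gF hk hA hB; have [u [w hE]] := gF _ h hk hA hB.
have hE' : h = pihomog mdeg 1 u * F + pihomog mdeg 0 w * G.
  rewrite -[LHS](pihomog_dE hk) hE pihomogD (pihomogMr _ _ Fk) (pihomogMr _ _ Gk).
  by rewrite leqnSn leqnn subnn subSnn.
have [c0 [c1 [c2 lE]]] := linear_form (pihomogP mdeg 1 u).
exists c0, c1, c2, (pihomog mdeg 0 w)@_0.
by rewrite -lE -mul_mpolyC -(dhomog0_const (pihomogP mdeg 0 w)).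
Qed.

Lemma general_odd k A B : size A = k.+1 -> size B = k -> uniq (A ++ B) -> (0 < k)%N ->
  general_in (fun v : dhomog 3 K k => vanish Q A v /\ vanish Q B v)
    (fun v : dhomog 3 K k => irreducible_elt (mpoly_of_dhomog v)).
Proof.
move=> sA sB uAB k0; have [F0 [F1 [F0k F1k bF gF]]] := bezout_odd_exists Q_unit sA sB uAB.
have [bad badP] := bezout_pencil_irreducible Q_unit sA sB uAB k0 F0k F1k bF.
pose X := [tuple DHomog F1k; DHomog F0k].
have inA i : (i < k.+1)%N -> A`_i \in A by move=> ik; rewrite mem_nth ?sA.
have uA : uniq A by move: uAB; rewrite cat_uniq => /andP[].
have free_X : free X.
  apply/freeP => c; rewrite !big_ord_recl big_ord0 /= addr0 => /(congr1 val) /= c0.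
  have E i : (i < k.+1)%N -> c ord0 * A`_i + c (lift ord0 ord0) = 0.
    move=> ik; have [e1 e0] := bezout_odd_rst (inA i ik) bF.
    have /eqP := congr1 (rst A`_i) c0.
    rewrite -[X in rst _ X]/(c ord0 *: F1 + c (lift ord0 ord0) *: F0).
    rewrite rstD !rstZ rst0 e1 e0 scalerA -scalerDl scalerA.
    rewrite scaler_eq0 (negbTE (pol_neq0 _)) orbF mulf_eq0 => /orP[/eqP //|].
    rewrite pol_eq0 => iB; move: uAB; rewrite cat_uniq => /and3P[_ /hasPn /(_ _ iB)].
    by rewrite /= inA.
  have c00 : c ord0 = 0.
    have : c ord0 * (A`_1 - A`_0) = 0.
      transitivity ((c ord0 * A`_1 + c (lift ord0 ord0)) - (c ord0 * A`_0 + c (lift ord0 ord0))).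
        by ring.
      by rewrite !E ?subrr.
    move/eqP; rewrite mulf_eq0 subr_eq0 nth_uniq ?sA //= orbF.
    by move/eqP.
  have c10 : c (lift ord0 ord0) = 0 by have := E 0%N isT; rewrite c00 mul0r add0r.
  by move=> i; case: (unliftP ord0 i) => [j ->|->] //; rewrite (ord1 j).
have coordX (v : dhomog 3 K k) c1 c0 : mpoly_of_dhomog v = c1 *: F1 + c0 *: F0 ->
    coord X ord0 v = c1 /\ coord X (lift ord0 ord0) v = c0.
  move=> vE; have -> : v = \sum_(i < 2) [:: c1; c0]`_i *: X`_i.
    by apply: val_inj; rewrite !big_ord_recl big_ord0 /= addr0 vE.
  by rewrite !coord_sum_free.
(* For [c1 F1 + c0 F0] this is nonzero exactly when [c1] is nonzero and [- c0 / c1] is not a bad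
   parameter. *)
pose phi v := coord X ord0 v *
  \prod_(t <- bad) (coord X (lift ord0 ord0) v + t * coord X ord0 v).
have vF t : vanish Q A (F1 - t *: F0) /\ vanish Q B (F1 - t *: F0).
  have [v1 v2 v3 v4] := bezout_odd_vanish bF.
  by split; apply: vanishB => //; apply: vanishZ.
have [t tbad] := exists_notin bad.
apply: (@general_in_polyfun _ _ _ _ phi).
- apply: polyfunM; first exact: polyfun_coord.
  apply: polyfun_prod => s _; apply: polyfunD; first exact: polyfun_coord.
  by apply: polyfunZ; exact: polyfun_coord.
- have Mk : F1 - t *: F0 \is k.-homog by rewrite rpredB ?rpredZ.
  exists (DHomog Mk); split; first exact: vF.
  have [|e1 e0] := coordX (DHomog Mk) 1 (- t); first by rewrite /= scale1r scaleNr.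
  rewrite /phi e1 e0 mul1r prodf_seq_neq0.
  apply/allP => s sbad; rewrite mulr1 addrC subr_eq0; apply: contraNneq tbad => <-.
  exact: sbad.
move=> v [vA vB]; have [c1 [c0 vE]] := generates_odd F0k F1k gF (dhomog_is_dhomog v) vA vB.
have [e1 e0] := coordX v _ _ vE.
rewrite /phi e1 e0 mulf_eq0 negb_or prodf_seq_neq0 => /andP[c1n /allP cbad].
have -> : mpoly_of_dhomog v = c1 *: (F1 - (- c0 / c1) *: F0).
  by rewrite -[LHS]/(val v) vE scalerBr scalerA mulrCA mulfV // mulr1 scaleNr opprK.
apply: irreducible_scale => //; apply: badP; apply/negP => tb.
by have := cbad _ tb; rewrite /= divfK // subrr eqxx.
Qed.

Lemma bezout_even_swap A B F G : bezout_even Q A B F G -> bezout_even Q B A (- F) G.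
Proof.
move=> bF a b; rewrite evN [(pol B).[a] * _]mulrC -(bF b a) evC [ev G _ _]evC; ring.
Qed.

Lemma bezout_even_rst A B F G a : a \in A -> bezout_even Q A B F G ->
  (forall y, ev G a y = (y - a) * ev F a y) /\ rst a F = (pol B).[a] *: pol (rem a A).
Proof.
move=> aA bF.
have EG z : ev G a z = (z - a) * ev F a z.
  have := bF a z; rewrite pol_root // mul0r mulr0 => /eqP.
  by rewrite addrC addr_eq0 => /eqP ->; ring.
split=> //; have X0 : 'X - a%:P != 0 :> {poly K} by rewrite polyXsubC_eq0.
apply: (mulfI X0); rewrite -scalerAr -pol_rem //; apply: poly_ext => z.
rewrite hornerM hornerXsubC hornerZ horner_rst [RHS]mulrC.
have two : 2 != 0 :> K by rewrite pnatr_eq0.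
by apply: (mulfI two); rewrite -bF ![ev _ z a]evC EG; ring.
Qed.

(** A member has degree one more than the number of star points on the tangent [a]; the last factor,
    affine in [y], gives the residual point. *)
Lemma bezout_even_ev A B F G a y c0 c1 c2 c3 : a \in A -> bezout_even Q A B F G ->
  ev ((c0 *: xx + c1 *: yy + c2 *: zz) * F + c3 *: G) a y =
    (pol B).[a] * (pol (rem a A)).[y] *
      ((c0 + c1 * a + c3) * y + (a * (c0 - c3) + c2)).
Proof.
move=> aA bF; have [EG EF] := bezout_even_rst aA bF.
by rewrite evD evZ evM EG -[ev F a y]horner_rst EF hornerZ !evE; ring.
Qed.

(* The residual point of the member with coordinates [c0, c1, c2, c3] on the tangent [a]. *)
Let residual a c0 c1 c2 c3 := let d := c0 + c1 * a + c3 in let n := a * (c0 - c3) + c2 in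
  pt Q (a * d - n) (- (a * n)) d.

(** [residual] is the intersection of the tangent [a] with the one at the root of the affine factor,
    scaled by [d] so that its coordinates are polynomial in the coefficients. *)
Let residual_eval n f a c0 c1 c2 c3 (d := c0 + c1 * a + c3) : f \is n.-homog -> d != 0 ->
  f.@[residual a c0 c1 c2 c3 0] = d ^+ n * ev f a (- (a * (c0 - c3) + c2) / d).
Proof.
move=> fn d0; apply: dhomog_eval fn _ => k; rewrite !ptE -/d.
by field.
Qed.

(** The test points for [irreducible_open] are the two stars and the residual points. At the chosen
    member the residual points have second parameter [t] on the tangents of [A] and [t'] on those of
    [B], and only its multiples pass through all of them. *)
Lemma general_even k A B : size A = k.+1 -> size B = k.+1 -> uniq (A ++ B) -> (0 < k)%N ->
  general_in (fun v : dhomog 3 K k.+1 => vanish Q A v /\ vanish Q B v)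
    (fun v : dhomog 3 K k.+1 => irreducible_elt (mpoly_of_dhomog v)).
Proof.
move=> sA sB uAB k0; have [F [G [Fk Gk bF gF]]] := bezout_even_exists Q_unit sA sB uAB.
have bF' := bezout_even_swap bF.
have crdM i : crd Q i * F \is k.+1.-homog.
  by have := dhomogM (crd_homog Q i) Fk; rewrite add1n.
pose o1 : 'I_4 := lift ord0 ord0; pose o2 : 'I_4 := lift ord0 (lift ord0 ord0).
pose o3 : 'I_4 := lift ord0 (lift ord0 (lift ord0 ord0)).
pose X := [tuple DHomog (crdM ord0); DHomog (crdM (lift ord0 ord0));
  DHomog (crdM (lift ord0 (lift ord0 ord0))); DHomog Gk].
pose M c0 c1 c2 c3 := (c0 *: xx + c1 *: yy + c2 *: zz) * F + c3 *: G.
have M_swap c0 c1 c2 c3 :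
    M c0 c1 c2 c3 = (- c0 *: xx + - c1 *: yy + - c2 *: zz) * (- F) + c3 *: G.
  by rewrite /M !scaleNr; ring.
have [/= uA uB AB] : [/\ uniq A, uniq B & forall a, a \in A -> a \notin B].
  move: uAB; rewrite cat_uniq => /and3P[-> /hasPn AB ->]; split=> // a aA.
  by apply/negP => /AB; rewrite /= aA.
have inA i : (i < k.+1)%N -> A`_i \in A by move=> ik; rewrite mem_nth ?sA.
have inB i : (i < k.+1)%N -> B`_i \in B by move=> ik; rewrite mem_nth ?sB.
have MX (c : 'I_4 -> K) : mpoly_of_dhomog (\sum_i c i *: X`_i) =
    M (c ord0) (c o1) (c o2) (c o3).
  by rewrite !big_ord_recl big_ord0 /= addr0 /M !addrA !mulrDl !scalerAl.
have affine_eq0 (s : seq K) u w : uniq s -> size s = k.+1 ->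
    (forall a, a \in s -> u * a + w = 0) -> u = 0 /\ w = 0.
  move=> us ss E; have E0 := E s`_0; have E1 := E s`_1.
  have u0 : u = 0.
    have : u * (s`_1 - s`_0) = 0.
      transitivity ((u * s`_1 + w) - (u * s`_0 + w)); first by ring.
      by rewrite E0 ?E1 ?subrr ?mem_nth ?ss.
    by move/eqP; rewrite mulf_eq0 subr_eq0 nth_uniq ?ss //= orbF => /eqP.
  by split=> //; have := E0; rewrite u0 mul0r add0r => -> //; rewrite mem_nth ?ss.
have pol_rem_neq0 s a y : y \notin s -> (pol (rem a s)).[y] != 0.
  by move=> ys; rewrite pol_eq0; apply: contra ys => /mem_rem.
have M_root c0 c1 c2 c3 a y : a \in A -> y \notin A -> ev (M c0 c1 c2 c3) a y = 0 ->
    (c0 + c1 * a + c3) * y + (a * (c0 - c3) + c2) = 0.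
  move=> aA yA; rewrite /M (bezout_even_ev _ _ _ _ _ aA bF) => /eqP.
  by rewrite !mulf_eq0 (negbTE (pol_rem_neq0 _ _ _ yA)) pol_eq0 (negbTE (AB _ aA)) => /eqP.
have M_root' c0 c1 c2 c3 b y : b \in B -> y \notin B -> ev (M c0 c1 c2 c3) b y = 0 ->
    (- c0 + - c1 * b + c3) * y + (b * (- c0 - c3) + - c2) = 0.
  move=> bB yB; rewrite M_swap (bezout_even_ev _ _ _ _ _ bB bF') => /eqP.
  have bA : b \notin A by apply/negP => /AB; rewrite bB.
  by rewrite !mulf_eq0 (negbTE (pol_rem_neq0 _ _ _ yB)) pol_eq0 (negbTE bA) => /eqP.
have [y yA] := exists_notin A; have [y' yA'] := exists_notin (y :: A).
have free_X : free X.
  apply/freeP => c c0; have M0 : M (c ord0) (c o1) (c o2) (c o3) = 0 by rewrite -MX c0.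
  (* For fixed [z] the condition is affine in [a], which takes at least two values; two values of
     [z] then kill all coefficients. *)
  have L z : z \notin A -> c o1 * z + (c ord0 - c o3) = 0 /\ (c ord0 + c o3) * z + c o2 = 0.
    move=> zA; apply: (affine_eq0 A) => // a aA.
    have e : ev (M (c ord0) (c o1) (c o2) (c o3)) a z = 0 by rewrite M0 ev0.
    by rewrite -[RHS](M_root _ _ _ _ a z aA zA e); ring.
  move: yA'; rewrite inE negb_or => /andP[yy' yA'].
  have [e1 e2] := L y yA; have [e3 e4] := L y' yA'.
  have affine2 u w : u * y + w = 0 -> u * y' + w = 0 -> u = 0 /\ w = 0.
    move=> h1 h2; have u0 : u = 0.
      have : u * (y' - y) = 0.
        by transitivity ((u * y' + w) - (u * y + w)); [ring | rewrite h1 h2 subrr].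
      by move/eqP; rewrite mulf_eq0 subr_eq0 (negbTE yy') orbF => /eqP.
    by split=> //; move: h1; rewrite u0 mul0r add0r.
  have [z1 /eqP] := affine2 _ _ e1 e3; rewrite subr_eq0 => /eqP z03.
  have [/eqP + z2] := affine2 _ _ e2 e4.
  rewrite z03 -mulr2n mulrn_eq0 /= => /eqP z3.
  have z0 : c ord0 = 0 by rewrite z03.
  move=> i; case: (unliftP ord0 i) => [{}i ->|-> //]; case: (unliftP ord0 i) => [{}i ->|-> //].
  by case: (unliftP ord0 i) => [{}i ->|-> //]; rewrite (ord1 i).
have coordX (v : dhomog 3 K k.+1) c0 c1 c2 c3 : mpoly_of_dhomog v = M c0 c1 c2 c3 ->
    [/\ coord X ord0 v = c0, coord X o1 v = c1, coord X o2 v = c2 & coord X o3 v = c3].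
  move=> vE; have -> : v = \sum_(i < 4) [:: c0; c1; c2; c3]`_i *: X`_i.
    by apply: val_inj; rewrite -[RHS]/(mpoly_of_dhomog _) MX /= vE.
  by rewrite !coord_sum_free.
(* A member of the family vanishing on the stars of [t :: A] and [t' :: B]. *)
have [t tAB] := exists_notin (A ++ B); move: (tAB); rewrite mem_cat negb_or => /andP[tA tB].
have [F0k F1k bF01 gF01] := bezout_even_odd Q_unit (c := t) sA
  (introT andP (conj tAB uAB)) Fk Gk bF gF.
have [bad badP] := bezout_pencil_irreducible Q_unit (A := t :: A)
  (congr1 S sA) sB (introT andP (conj tAB uAB)) (ltn0Sn k) F0k F1k bF01.
have [t'] := exists_notin (bad ++ A ++ B).
rewrite !mem_cat !negb_or => /and3P[/badP M0irr t'A t'B].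
set M0 := _ - _ in M0irr.
(* The coefficients come from expanding the pencil of [bezout_even_odd] in terms of [F] and [G]. *)
have M0E : M0 = M (- (t + t') / 2) 1 (t * t') ((t - t') / 2).
  have two : 2 * (2^-1)%:MP = 1 :> {mpoly K[3]}.
    by rewrite -(mpolyC_nat _ _ 2) -rmorphM mulfV ?pnatr_eq0 // rmorph1.
  rewrite /M0 /M -!mul_mpolyC !rmorphM !rmorphB !rmorphN !rmorphD /= mpolyC1.
  transitivity ((2^-1)%:MP * ((t%:MP - t'%:MP) * G - (t%:MP + t'%:MP) * (xx * F))
    + (2 * (2^-1)%:MP) * (yy * F + t%:MP * t'%:MP * (zz * F))); first by ring.
  by rewrite two; ring.
have M0k : M0 \is k.+1.-homog by apply: rpredB => //; apply: rpredZ.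
pose v0 : dhomog 3 K k.+1 := DHomog M0k.
have [c00 c01 c02 c03] := coordX v0 _ _ _ _ M0E.
pose r := k.+1; pose T := ('I_r * 'I_r + 'I_r * 'I_r + 'I_r + 'I_r)%type.
(* A diagonal pair, which gives no point of the star, is sent to the zero vector, where every form
   of positive degree vanishes. *)
pose star s (ij : 'I_r * 'I_r) := if s`_(ij.1) == s`_(ij.2) then 0 else spt Q s`_(ij.1) s`_(ij.2).
pose P (e : T) v := match e with
  | inl (inl (inl ij)) => star A ij
  | inl (inl (inr ij)) => star B ij
  | inl (inr i) => residual A`_i (coord X ord0 v) (coord X o1 v) (coord X o2 v) (coord X o3 v)
  | inr j => residual B`_j (- coord X ord0 v) (- coord X o1 v) (- coord X o2 v) (coord X o3 v)
  end.
have pc i := polyfun_coord X i.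
have pcN i : polyfun (fun v => - coord X i v).
  by apply: polyfun_ext (polyfunZ (-1) (pc i)) => v; rewrite mulN1r.
have p_residual a (u0 u1 u2 u3 : dhomog 3 K k.+1 -> K) : polyfun u0 -> polyfun u1 -> polyfun u2 ->
    polyfun u3 -> forall l, polyfun (fun v => residual a (u0 v) (u1 v) (u2 v) (u3 v) 0 l).
  move=> p0 p1 p2 p3 l.
  have pd : polyfun (fun v => u0 v + u1 v * a + u3 v).
    by apply: polyfunD p3; apply: polyfunD p0 _; apply: polyfunM p1 (polyfun_const _ _).
  have pn : polyfun (fun v => a * (u0 v - u3 v) + u2 v).
    by apply: polyfunD p2; apply: polyfunZ; apply: polyfunB.
  apply: (@polyfun_ext _ _ (fun v =>
      (a * (u0 v + u1 v * a + u3 v) - (a * (u0 v - u3 v) + u2 v)) * Q ord0 l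
    + (- a * (a * (u0 v - u3 v) + u2 v)) * Q (lift ord0 ord0) l
    + (u0 v + u1 v * a + u3 v) * Q (lift ord0 (lift ord0 ord0)) l)) => [v|].
    by rewrite ptE mulNr.
  apply: polyfunD; [apply: polyfunD|]; apply: polyfunM (polyfun_const _ _) => //.
    by apply: polyfunB => //; apply: polyfunZ.
  exact: polyfunZ.
have [sAr sBr] : size A = r /\ size B = r by [].
have polyP (e : T) l : polyfun (fun v => P e v 0 l).
  by case: e => [[[ij|ij]|i]|j];
     [apply: polyfun_const|apply: polyfun_const|apply: p_residual|apply: p_residual].
have d0 i : (i < r)%N -> coord X ord0 v0 + coord X o1 v0 * A`_i + coord X o3 v0 = A`_i - t'.
  by move=> ir; rewrite c00 c01 c03; field.
have d0' i : (i < r)%N ->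
    - coord X ord0 v0 + - coord X o1 v0 * B`_i + coord X o3 v0 = t - B`_i.
  by move=> ir; rewrite c00 c01 c03; field.
have [|phi [pf f0 fP]] := irreducible_open polyP (n := r) (v0 := v0) isT.
  move=> p q U W p0 q0 pq Up Wq UW0; have UWr : U * W \is r.-homog by rewrite -pq dhomogM.
  have vsub s (h : forall ij : 'I_r * 'I_r, (U * W).@[star s ij 0] = 0) : size s = r ->
      vanish Q s (U * W).
    move=> ss a b aA bA ab.
    have ai : (index a s < r)%N by rewrite -ss index_mem.
    have bi : (index b s < r)%N by rewrite -ss index_mem.
    by have := h (Ordinal ai, Ordinal bi); rewrite /star /= !nth_index // (negbTE ab).
  have vA := vsub A (fun ij => UW0 (inl (inl (inl ij)))) sA.
  have vB := vsub B (fun ij => UW0 (inl (inl (inr ij)))) sB.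
  have [c0 [c1 [c2 [c3 UWE]]]] := generates_even Fk Gk gF UWr vA vB.
  have EA a : a \in A -> (c0 + c1 * a + c3) * t + (a * (c0 - c3) + c2) = 0.
    move=> aA; apply: M_root => //; rewrite /M -UWE.
    have ai : (index a A < r)%N by rewrite -sAr index_mem.
    have := UW0 (inl (inr (Ordinal ai))); rewrite /P (@residual_eval _ _ _ _ _ _ _ UWr) /= d0 //.
      rewrite c00 c02 c03 nth_index // => /eqP; rewrite mulf_eq0 expf_eq0 subr_eq0 /=.
      have -> : (a == t') = false by apply: contraNF t'A => /eqP <-.
      have at' : a - t' != 0 by rewrite subr_eq0; apply: contraNneq t'A => <-.
      rewrite orFb => /eqP <-; congr (ev _ _ _); field.
      exact: at'.
    by rewrite nth_index // subr_eq0; apply: contraNneq t'A => <-.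
  have EB b : b \in B -> (- c0 + - c1 * b + c3) * t' + (b * (- c0 - c3) + - c2) = 0.
    move=> bB; apply: M_root' => //; rewrite /M -UWE.
    have bi : (index b B < r)%N by rewrite -sBr index_mem.
    have := UW0 (inr (Ordinal bi)); rewrite /P (@residual_eval _ _ _ _ _ _ _ UWr) /= d0' //.
      rewrite c00 c02 c03 nth_index // => /eqP; rewrite mulf_eq0 expf_eq0 subr_eq0 /=.
      have -> : (t == b) = false by apply: contraNF tB => /eqP ->.
      have bt : t - b != 0 by rewrite subr_eq0; apply: contraNneq tB => ->.
      rewrite orFb => /eqP <-; congr (ev _ _ _); field.
      exact: bt.
    by rewrite nth_index // subr_eq0; apply: contraNneq tB => ->.
  (* Affine in the parameter and zero on all of [A], resp. [B], so both coefficients vanish; the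
     four equations fix [c0], [c2] and [c3] in terms of [c1]. *)
  have [h1 h2] : c1 * t + (c0 - c3) = 0 /\ (c0 + c3) * t + c2 = 0.
    by apply: (affine_eq0 A) => // a aA; rewrite -[RHS](EA a aA); ring.
  have [h3 h4] : - c1 * t' + (- c0 - c3) = 0 /\ (c3 - c0) * t' - c2 = 0.
    by apply: (affine_eq0 B) => // b bB; rewrite -[RHS](EB b bB); ring.
  have two : 2 != 0 :> K by rewrite pnatr_eq0.
  have g0 : c0 = c1 * (- (t + t') / 2).
    apply: (mulfI two); apply/eqP; rewrite -subr_eq0; apply/eqP.
    transitivity ((c1 * t + (c0 - c3)) - (- c1 * t' + (- c0 - c3))); last by rewrite h1 h3 subrr.
    by field.
  have g3 : c3 = c1 * ((t - t') / 2).
    apply: (mulfI two); apply/eqP; rewrite -subr_eq0; apply/eqP.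
    transitivity (- (c1 * t + (c0 - c3)) - (- c1 * t' + (- c0 - c3))); last by rewrite h1 h3; ring.
    by field.
  have g2 : c2 = c1 * (t * t').
    apply/eqP; rewrite -subr_eq0; apply/eqP; rewrite -[RHS]h2 g0 g3; by field.
  have UWM : U * W = c1 *: M0.
    rewrite UWE M0E /M g0 g2 g3 -!scalerA scalerDr scalerAl !scalerDr.
    by rewrite [c1 *: (1 *: _)]scalerA mulr1.
  have [c10|c1n] := eqVneq c1 0; first by rewrite UWM c10 scale0r.
  have [_ _ /(_ (c1^-1 *: U) W)] := M0irr.
  rewrite -scalerAl UWM scalerA mulVf // scale1r => /(_ erefl) [].
    by rewrite (negbTE (dhomog_not_unit p0 _)) // rpredZ.
  by rewrite (negbTE (dhomog_not_unit q0 _)).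
(* Besides [phi], the open condition asks that [c1] be nonzero, so that the member is not 0, and
   that the leading coefficients on all tangents be nonzero, so that [residual_eval] applies. *)
pose dA v a := coord X ord0 v + coord X o1 v * a + coord X o3 v.
pose dB v b := - coord X ord0 v + - coord X o1 v * b + coord X o3 v.
apply: (@general_in_polyfun _ _ _ _
  (fun v => phi v * (coord X o1 v * ((\prod_(i < r) dA v A`_i) * (\prod_(i < r) dB v B`_i))))).
- apply: polyfunM pf _; apply: polyfunM (pc _) _; apply: polyfunM; apply: polyfun_prod => i _.
    by apply: polyfunD (pc _); apply: polyfunD (pc _) _; apply: polyfunM (pc _) (polyfun_const _ _).
  by apply: polyfunD (pc _); apply: polyfunD (pcN _) _; apply: polyfunM (pcN _) (polyfun_const _ _).
- exists v0; split.
    have [v1 v2 v3 v4] := bezout_odd_vanish bF01.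
    split; last by apply: vanishB => //; apply: vanishZ.
    by apply: (@vanish_cons _ _ t); apply: vanishB => //; apply: vanishZ.
  rewrite !mulf_neq0 // ?c01 ?oner_eq0 //; apply/prodf_neq0 => i _.
    by rewrite /dA d0 // subr_eq0; apply: contraNneq t'A => <-; apply: inA.
  by rewrite /dB d0' // subr_eq0; apply: contraNneq tB => ->; apply: inB.
move=> v [vA vB]; rewrite !mulf_eq0 !negb_or => /and4P[fv c1v /prodf_neq0 dAv /prodf_neq0 dBv].
have vr := dhomog_is_dhomog v.
have [c0 [c1 [c2 [c3 vE]]]] := generates_even Fk Gk gF vr vA vB.
have [e0 e1 e2 e3] := coordX v _ _ _ _ vE.
apply: (fP v _ fv _ vr).
  apply: contraNneq c1v => v0'; have /coordX[_ -> _ _] // : mpoly_of_dhomog v = M 0 0 0 0.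
  by rewrite v0' /M !scale0r !addr0 mul0r.
case=> [[[ij|ij]|i]|j] /=.
- rewrite /star; case: eqVneq => [_|ne].
    have E0 l : (0 : 'rV[K]_3) 0 l = 0 * 0 by rewrite mxE mul0r.
    by rewrite (@dhomog_eval _ _ _ _ 0 (fun=> 0) _ vr E0) exprS !mul0r.
  by apply: vA => //; apply: inA.
- rewrite /star; case: eqVneq => [_|ne].
    have E0 l : (0 : 'rV[K]_3) 0 l = 0 * 0 by rewrite mxE mul0r.
    by rewrite (@dhomog_eval _ _ _ _ 0 (fun=> 0) _ vr E0) exprS !mul0r.
  by apply: vB => //; apply: inB.
- have di := dAv i isT; rewrite (@residual_eval _ _ _ _ _ _ _ vr di).
  rewrite -[X in ev X]/(mpoly_of_dhomog v) vE (bezout_even_ev _ _ _ _ _ (inA _ (ltn_ord i)) bF).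
  by rewrite -e0 -e1 -e2 -e3 [_ * (- _ / _)]mulrC divfK // addNr !mulr0.
have di := dBv j isT; rewrite (@residual_eval _ _ _ _ _ _ _ vr di).
rewrite -[X in ev X]/(mpoly_of_dhomog v) vE -/(M _ _ _ _) M_swap.
rewrite (bezout_even_ev _ _ _ _ _ (inB _ (ltn_ord j)) bF').
by rewrite -e0 -e1 -e2 -e3 [_ * (- _ / _)]mulrC divfK // addNr !mulr0.
Qed.

End General.

(** * Normal form of a conic *)

Lemma mderiv_homog n (K : fieldType) d (f : {mpoly K[n]}) i :
  f \is d.+1.-homog -> f^`M(i) \is d.-homog.
Proof.
move=> fd; apply/dhomogP => m; rewrite mcoeff_msupp mcoeff_deriv => mf.
have mf' : (m + U_(i))%MM \in msupp f.
  by rewrite mcoeff_msupp; apply: contraNneq mf => ->; rewrite mul0rn.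
by have /eqP := dhomog_mf fd mf'; rewrite /= mdegD mdeg1 addn1 eqSS => /eqP.
Qed.

Lemma euler_homog n (K : fieldType) d (f : {mpoly K[n]}) :
  f \is d.-homog -> \sum_i f^`M(i) * 'X_i = d%:R *: f.
Proof.
move=> fd; transitivity (\sum_(m <- msupp f) f@_m *: \sum_i 'X_[m]^`M(i) * 'X_i).
  under [RHS]eq_bigr => m _ do rewrite scaler_sumr.
  rewrite exchange_big; apply: eq_bigr => i _.
  rewrite [in LHS](mpolyE f) linear_sum mulr_suml; apply: eq_bigr => m _.
  by rewrite /= linearZ /= scalerAl.
rewrite [f in RHS]mpolyE scaler_sumr big_seq [RHS]big_seq; apply: eq_bigr => m mf.
rewrite scalerA mulrC -scalerA; congr (_ *: _); rewrite -(dhomog_mf fd mf) /= mdegE.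
rewrite natr_sum scaler_suml; apply: eq_bigr => i _.
rewrite mderivX -scalerAl; have [mi|mi] := eqVneq (m i) 0%N.
  by rewrite mi !scale0r.
by rewrite -mpolyXD submK // lep1mP.
Qed.

Lemma orthogonal_pair (K : fieldType) (u v : 'cV[K]_3) :
  exists g : 'rV[K]_3, [/\ g != 0, g *m u = 0 & g *m v = 0].
Proof.
pose N : 'M[K]_(3, 1 + 1) := row_mx u v.
have /rowV0Pn [g gN g0] : kermx N != 0.
  by rewrite -mxrank_eq0 mxrank_ker subn_eq0 -ltnNge ltnS rank_leq_col.
exists g; have := sub_kermxP gN; rewrite mul_mx_row => /eqP.
by rewrite -row_mx0 => /eqP/eq_row_mx[].
Qed.

Lemma rows_unitmx (K : fieldType) (u v w : 'rV[K]_3) :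
  (forall a b c, a *: u + b *: v + c *: w = 0 -> [/\ a = 0, b = 0 & c = 0]) ->
  \matrix_(i < 3) [:: u; v; w]`_i \in unitmx.
Proof.
move=> ind; rewrite -row_free_unit; apply: inj_row_free => x.
rewrite mulmx_sum_row !big_ord_recl big_ord0 !rowK /= addr0 addrA => /ind[a b c].
apply/rowP => i; rewrite mxE.
by case: (unliftP ord0 i) => [{}i ->|-> //]; case: (unliftP ord0 i) => [{}i ->|-> //];
   rewrite (ord1 i).
Qed.

Lemma pt_rows (K : numFieldType) (u v w : 'rV[K]_3) a b c :
  pt (\matrix_(i < 3) [:: u; v; w]`_i) a b c = a *: u + b *: v + c *: w.
Proof.
by rewrite /pt mulmx_sum_row !big_ord_recl big_ord0 !rowK /= !mxE addr0 addrA.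
Qed.

Section Conic.
Variables (K : numFieldType) (q : {mpoly K[3]}).
Hypotheses (q2 : q \is 2.-homog) (q_irr : irreducible_elt q).
Implicit Types (u v w g : 'rV[K]_3) (Q : 'M[K]_3).

(** The polar bilinear form of the conic: [tangent_at] describes the tangent at [v] as its zero set
    in [w]. *)
Definition polar v w := \sum_(i < 3) (q^`M(i)).@[v 0] * w 0 i.

Let hessian (i k : 'I_3) := (q^`M(i))@_U_(k).

Let hessianC i k : hessian i k = hessian k i.
Proof. by rewrite /hessian !mcoeff_deriv !mnm1E addmC eq_sym. Qed.

Let polarE v w : polar v w = \sum_i \sum_k hessian i k * (v 0 k * w 0 i).
Proof.
apply: eq_bigr => i _; rewrite (linear_form_eval _ (mderiv_homog i q2)) mulr_suml.
by apply: eq_bigr => k _; rewrite mulrA.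
Qed.

Lemma polarC v w : polar v w = polar w v.
Proof.
rewrite !polarE exchange_big; apply: eq_bigr => i _; apply: eq_bigr => k _.
by rewrite hessianC [_ * w 0 _]mulrC.
Qed.

Lemma polarDr u v w : polar u (v + w) = polar u v + polar u w.
Proof. by rewrite /polar -big_split; apply: eq_bigr => i _; rewrite mxE mulrDr. Qed.

Lemma polarZr c u v : polar u (c *: v) = c * polar u v.
Proof. by rewrite /polar mulr_sumr; apply: eq_bigr => i _; rewrite mxE mulrCA. Qed.

Lemma polarDl u v w : polar (v + w) u = polar v u + polar w u.
Proof. by rewrite !(polarC _ u) polarDr. Qed.

Lemma polarZl c u v : polar (c *: v) u = c * polar v u.
Proof. by rewrite !(polarC _ u) polarZr. Qed.

Lemma polar_diag v : polar v v = 2 * q.@[v 0].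
Proof.
rewrite -mevalZ -(euler_homog q2) rmorph_sum; apply: eq_bigr => i _ /=.
by rewrite mevalM mevalXU.
Qed.

Lemma polar_kernel v w : polar v w = ((\row_i (q^`M(i)).@[v 0]) *m w^T) 0 0.
Proof. by rewrite mxE; apply: eq_bigr => i _; rewrite !mxE. Qed.

Definition independent v w := forall a b, a *: v + b *: w = 0 -> a = 0 /\ b = 0.

(** Otherwise [q] vanishes on the line through [v] and [w] and is divisible by the equation [z] of
    that line, against irreducibility. *)
Lemma isotropic_pair v w : independent v w -> q.@[v 0] = 0 -> q.@[w 0] = 0 -> polar v w != 0.
Proof.
move=> ind qv qw; apply/negP => /eqP vw0.
have [g [g0 gv gw]] := orthogonal_pair v^T w^T.
have [k gk] : exists k, g 0 k != 0.
  apply: NNPP => h; case/eqP: g0; apply/rowP => k; rewrite mxE.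
  by apply: NNPP => gk; apply: h; exists k; apply/eqP.
pose u : 'rV[K]_3 := delta_mx 0 k.
pose Q : 'M[K]_3 := \matrix_(i < 3) [:: v; w; u]`_i.
have Qu : Q \in unitmx.
  apply: rows_unitmx => a b c abc.
  have c0 : c = 0.
    have /(congr1 (fun M : 'M_1 => M 0 0)) : g *m (a *: v + b *: w + c *: u)^T = 0.
      by rewrite abc trmx0 mulmx0.
    rewrite !linearD /= !linearZ /= gv gw !scaler0 !add0r trmx_delta.
    rewrite -colE !mxE => /eqP; rewrite mulf_eq0 (negbTE gk) orbF.
    by move/eqP.
  by move: abc; rewrite c0 scale0r addr0 => /ind [].
pose y := crd Q (lift ord0 ord0); pose z := crd Q (lift ord0 (lift ord0 ord0)).
pose x := crd Q ord0.
have qE : q = z * (polar v u *: x + polar w u *: y + q.@[u 0] *: z).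
  apply/eqP; rewrite -subr_eq0; apply/eqP/mpoly_eval_eq0 => t.
  pose t' : 'rV[K]_3 := \row_k t k.
  have tE (p : {mpoly K[3]}) : p.@[t] = p.@[t' 0] by apply: meval_eq => l; rewrite mxE.
  rewrite !tE mevalB mevalM !mevalD !mevalZ.
  have two : 2 != 0 :> K by rewrite pnatr_eq0.
  apply: (mulfI two); rewrite mulr0 mulrBr -polar_diag {1 2}(pt_crd Qu t').
  rewrite pt_rows !(polarDl, polarDr, polarZl, polarZr) !polar_diag qv qw vw0.
  by rewrite (polarC w v) vw0 (polarC u v) (polarC u w) -/x -/y -/z; ring.
have [_ _ /(_ _ _ qE)[]] := q_irr; apply/negP.
  by apply: (dhomog_not_unit (d := 1)); rewrite ?crd_homog.
by apply: (dhomog_not_unit (d := 1)); rewrite ?rpredD ?rpredZ ?crd_homog.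
Qed.

(** The third basis vector [g] is polar to [v] and [w], and is not on the conic, since otherwise [v]
    and [g] would contradict [isotropic_pair]. The point [v] gets the coordinates [(0 : 1 : 0)], the
    contact point of parameter infinity. *)
Lemma conic_normal_form v w : independent v w -> q.@[v 0] = 0 -> q.@[w 0] = 0 ->
  exists Q (c : K), [/\ Q \in unitmx, c != 0, pt Q 0 1 0 = v &
    q = c *: (crd Q ord0 ^+ 2
              - 4 *: (crd Q (lift ord0 ord0) * crd Q (lift ord0 (lift ord0 ord0))))].
Proof.
move=> ind qv qw; have vw0 := isotropic_pair ind qv qw.
have [g [g0 gv gw]] := orthogonal_pair (\row_i (q^`M(i)).@[v 0])^T (\row_i (q^`M(i)).@[w 0])^T.
have pv : polar v g = 0.
  by rewrite polar_kernel -[_ *m g^T]trmxK trmx_mul trmxK gv trmx0 mxE.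
have pw : polar w g = 0.
  by rewrite polar_kernel -[_ *m g^T]trmxK trmx_mul trmxK gw trmx0 mxE.
have wv0 : polar w v != 0 by rewrite polarC.
have v0 : v != 0.
  by apply: contraNneq vw0 => ->; rewrite -(scale0r (0 : 'rV[K]_3)) polarZl mul0r.
have qg : q.@[g 0] != 0.
  apply/eqP => qg0; have : polar v g != 0; last by rewrite pv eqxx.
  apply: isotropic_pair => // a b abE.
  have a0 : a = 0.
    have : polar w (a *: v + b *: g) = 0 by rewrite abE -(scale0r (0 : 'rV[K]_3)) polarZr mul0r.
    rewrite polarDr !polarZr pw mulr0 addr0 => /eqP.
    by rewrite mulf_eq0 (negbTE wv0) orbF => /eqP.
  split=> //; move: abE; rewrite a0 scale0r add0r => /eqP.
  by rewrite scaler_eq0 (negbTE g0) orbF => /eqP.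
(* With the rows of [Q] below, the coefficient of [x^2] is [q(g) / (4 e^2)] and that of [y z] is
   [- polar v w / e]; this [e] makes their ratio [-1/4]. *)
pose e := q.@[g 0] / polar v w.
have e0 : e != 0 by rewrite mulf_neq0 ?invr_eq0.
have two : 2 != 0 :> K by rewrite pnatr_eq0.
pose Q : 'M[K]_3 := \matrix_(i < 3) [:: (- 2 * e)^-1 *: g; v; (- e)^-1 *: w]`_i.
have Qu : Q \in unitmx.
  apply: rows_unitmx => a b c abc.
  have P u : polar u (a *: ((- 2 * e)^-1 *: g) + b *: v + c *: ((- e)^-1 *: w)) = 0.
    by rewrite abc -(scale0r (0 : 'rV[K]_3)) polarZr mul0r.
  have c0 : c = 0.
    have := P v; rewrite !polarDr !polarZr pv polar_diag qv !mulr0 !add0r => /eqP.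
    by rewrite !mulf_eq0 invr_eq0 oppr_eq0 (negbTE e0) (negbTE vw0) !orbF => /eqP.
  have b0 : b = 0.
    have := P w; rewrite !polarDr !polarZr pw polar_diag qw !mulr0 !add0r !addr0 => /eqP.
    by rewrite mulf_eq0 (negbTE wv0) !orbF => /eqP.
  move: abc; rewrite b0 c0 !scale0r !addr0 => /eqP; rewrite !scaler_eq0 (negbTE g0) orbF.
  by rewrite invr_eq0 mulf_eq0 oppr_eq0 (negbTE two) (negbTE e0) !orbF => /eqP.
exists Q, (polar v w / (4 * e)); split=> //.
- by rewrite mulf_neq0 // invr_eq0 mulf_neq0 // pnatr_eq0.
- by rewrite pt_rows !scale0r scale1r add0r addr0.
apply/eqP; rewrite -subr_eq0; apply/eqP/mpoly_eval_eq0 => t.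
pose t' : 'rV[K]_3 := \row_k t k.
have tE (p : {mpoly K[3]}) : p.@[t] = p.@[t' 0] by apply: meval_eq => l; rewrite mxE.
rewrite !tE mevalB mevalZ mevalB mevalZ !mevalM.
apply: (mulfI two); rewrite mulr0 mulrBr -polar_diag {1 2}(pt_crd Qu t').
rewrite pt_rows !(polarDl, polarDr, polarZl, polarZr) !polar_diag qv qw pv pw.
rewrite (polarC w v) (polarC g v) (polarC g w) pv pw.
move: vw0 e0 qg; rewrite /e; move: (polar v w) (q.@[g 0]) => s d vw0 e0 qg.
by field; rewrite ?vw0 ?qg.
Qed.

End Conic.

(** * Finite parameters for all the tangents *)

Section TangentParameters.
Variables (K : numFieldType) (q : {mpoly K[3]}).
Hypotheses (q2 : q \is 2.-homog) (q_irr : irreducible_elt q).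
Implicit Types (u v w : 'rV[K]_3).

(** The normal form is used twice: first to parametrise the conic and find a point [u] away from the
    finitely many points of [S], then with [u] at infinity, which leaves a finite parameter to each
    point of [S]. *)
Lemma tangent_parameters (S : seq 'rV[K]_3) v0 w0 :
  (forall v, v \in S -> v != 0 /\ q.@[v 0] = 0) ->
  v0 \in S -> w0 \in S -> independent v0 w0 ->
  exists2 Q : 'M[K]_3, Q \in unitmx & forall v, v \in S ->
    exists a, forall w, (polar q v w == 0) = ((tl Q a).@[w 0] == 0).
Proof.
move=> S0 v0S w0S ind; have [v00 qv0] := S0 v0 v0S; have [w00 qw0] := S0 w0 w0S.
have [P [d [Pu d0 _ qP]]] := conic_normal_form q2 q_irr ind qv0 qw0.
have two : 2 != 0 :> K by rewrite pnatr_eq0.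
pose px v := (crd P ord0).@[v 0]; pose py v := (crd P (lift ord0 ord0)).@[v 0].
pose pz v := (crd P (lift ord0 (lift ord0 ord0))).@[v 0].
have [t tS] := exists_notin [seq px v / (2 * pz v) | v <- S].
(* [u] is a point of the conic off [S], to be sent to the parameter at infinity. *)
pose u := pt P (2 * t) (t ^+ 2) 1.
have qu : q.@[u 0] = 0.
  by rewrite qP mevalZ mevalB mevalZ !mevalM !crd_pt //=; ring.
have uv v : v \in S -> independent u v.
  move=> vS a b abE; have [v_neq0 qv] := S0 v vS.
  have : pt P (a * (2 * t) + b * px v) (a * t ^+ 2 + b * py v) (a + b * pz v) = 0.
    rewrite -[RHS]abE [v in RHS](pt_crd Pu v); apply/rowP => k.
    by rewrite [RHS]mxE [X in _ = X + _]mxE [X in _ = _ + X]mxE /u !ptE; ring.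
  case/(pt_eq0 Pu) => e1 e2 e3.
  have [b0|b0] := eqVneq b 0; first by move: e3; rewrite b0 mul0r addr0.
  have aE : a = - (b * pz v) by apply/eqP; rewrite -addr_eq0 e3.
  have xE : px v = 2 * t * pz v.
    apply: (mulfI b0); rewrite -[LHS]addr0 -[X in _ + X]oppr0 -[X in _ - X]e1 aE.
    by ring.
  have [z0|z0] := eqVneq (pz v) 0; last first.
    case/negP: tS; apply/mapP; exists v => //; rewrite xE; field.
    by rewrite z0.
  case/eqP: v_neq0; rewrite (pt_crd Pu v) -/(px v) -/(py v) -/(pz v) xE z0 mulr0.
  have -> : py v = 0.
    by apply: (mulfI b0); rewrite mulr0 -[RHS]e2 aE z0; ring.
  by apply/rowP => k; rewrite ptE mxE; ring.
have [Q [c [Qu c0 Q_u qQ]]] := conic_normal_form q2 q_irr (uv v0 v0S) qu qv0.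
exists Q => // v vS; have [v_neq0 qv] := S0 v vS.
pose x w := (crd Q ord0).@[w 0]; pose y w := (crd Q (lift ord0 ord0)).@[w 0].
pose z w := (crd Q (lift ord0 (lift ord0 ord0))).@[w 0].
have qE w : q.@[w 0] = c * (x w ^+ 2 - 4 * (y w * z w)).
  by rewrite qQ mevalZ mevalB mevalZ !mevalM.
have crdD i w w' : (crd Q i).@[(w + w') 0] = (crd Q i).@[w 0] + (crd Q i).@[w' 0].
  by rewrite !crd_eval mulmxDl mxE.
have x2 : x v ^+ 2 = 4 * (y v * z v).
  by move: qv; rewrite qE => /eqP; rewrite mulf_eq0 (negbTE c0) subr_eq0 => /eqP.
have z0 : z v != 0.
  apply/eqP => zv; have x0 : x v = 0.
    by apply/eqP; rewrite -sqrf_eq0 x2 zv !mulr0.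
  have : - y v *: u + 1 *: v = 0.
    rewrite -Q_u scale1r [X in _ + X](pt_crd Qu v) -/(x v) -/(y v) -/(z v) x0 zv.
    by apply/rowP => k; rewrite [LHS]mxE [X in X + _]mxE !ptE mxE; ring.
  by case/(uv v vS) => _ /eqP; rewrite oner_eq0.
(* The contact point with parameter [a] is [(2 a : a^2 : 1)], whence [a = x / (2 z)]. *)
exists (x v / (2 * z v)) => w.
have -> : polar q v w = - 4 * c * z v * (tl Q (x v / (2 * z v))).@[w 0].
  have -> : polar q v w = q.@[(v + w) 0] - q.@[v 0] - q.@[w 0].
    apply: (mulfI two); rewrite !mulrBr -!polar_diag // polarDl // !polarDr //.
    by rewrite (polarC q2 w v); ring.
  rewrite !qE /x /y /z !crdD -!/(x _) -!/(y _) -!/(z _) /tl mevalD mevalB !mevalZ.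
  rewrite -/(x w) -/(y w) -/(z w).
  transitivity (c * (2 * x v * x w - 4 * z v * y w - (4 * (y v * z v)) / z v * z w)).
    by field.
  by rewrite -x2; field; rewrite z0.
by rewrite !mulf_eq0 oppr_eq0 pnatr_eq0 (negbTE c0) (negbTE z0).
Qed.

End TangentParameters.

Lemma point_vline (K : fieldType) (p : point K) :
  exists2 v, v != 0 & val p = <[v]>%VS.
Proof.
case: p => U /= /eqP dU; exists (vpick U); first by rewrite vpick0 -dimv_eq0 dU.
apply/eqP; rewrite eq_sym eqEdim dU dim_vline vpick0 -dimv_eq0 dU andbT.
by rewrite -memvE memv_pick.
Qed.

Lemma vline_independent (K : fieldType) (v w : 'rV[K]_3) :
  v != 0 -> w != 0 -> <[v]>%VS != <[w]>%VS ->
  forall a b, a *: v + b *: w = 0 -> a = 0 /\ b = 0.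
Proof.
move=> v0 w0 vw a b abE; have [a0|a0] := eqVneq a 0.
  split=> //; move: abE; rewrite a0 scale0r add0r => /eqP.
  by rewrite scaler_eq0 (negbTE w0) orbF => /eqP.
case/eqP: vw; apply/eqP; rewrite eqEdim !dim_vline v0 w0 andbT -memvE.
apply/vlineP; exists (- (a^-1 * b)); apply: (scalerI a0).
by apply/eqP; rewrite scaleNr scalerN scalerA mulrA mulfV // mul1r -addr_eq0 abE.
Qed.

Lemma contact_parameters (K : numFieldType) (q : {mpoly K[3]}) r s
    (l : 'I_r -> line K) (m : 'I_s -> line K) :
  irreducible_conic q -> (2 <= r)%N -> contact_lines q l -> contact_lines q m ->
  exists (Q : 'M[K]_3) (a : 'I_r -> K) (b : 'I_s -> K), [/\ Q \in unitmx,
    forall i w, (w \in val (l i)) = ((tl Q (a i)).@[w 0] == 0) &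
    forall j w, (w \in val (m j)) = ((tl Q (b j)).@[w 0] == 0)].
Proof.
move=> [q2 q_irr] r2 [tl_ [tl_inj tlP]] [tm [tm_inj tmP]].
have vec n (t : 'I_n -> point K) : exists v : 'I_n -> 'rV[K]_3,
    forall i, v i != 0 /\ val (t i) = <[v i]>%VS.
  apply: (@fin_all_exists _ (fun=> 'rV[K]_3)
    (fun i v => v != 0 /\ val (t i) = <[v]>%VS)) => i.
  by have [v v0 tv] := point_vline (t i); exists v.
have [v vP] := vec _ tl_; have [w wP] := vec _ tm.
pose i0 : 'I_r := Ordinal (ltnW r2); pose i1 : 'I_r := Ordinal r2.
have ind : independent (v i0) (v i1).
  have [v0 t0] := vP i0; have [v1 t1] := vP i1.
  apply: vline_independent => //; rewrite -t0 -t1; apply/eqP => e.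
  by have := tl_inj _ _ (val_inj e).
have on_conic n (t : 'I_n -> point K) (h : 'I_n -> line K) u i :
    (forall i, vanishes_at q (t i) /\ tangent_at q (t i) (h i)) ->
    (forall i, u i != 0 /\ val (t i) = <[u i]>%VS) -> u i != 0 /\ q.@[u i 0] = 0.
  move=> tP uP; have [u0 ut] := uP i; split=> //.
  by apply: (tP i).1; rewrite ut memv_line.
have [||||Q Qu QP] := @tangent_parameters _ q q2 q_irr (codom v ++ codom w) (v i0) (v i1).
- move=> u; rewrite mem_cat => /orP[] /codomP[i ->].
    exact: on_conic tlP vP.
  exact: on_conic tmP wP.
- by rewrite mem_cat codom_f.
- by rewrite mem_cat codom_f.
- exact: ind.
have par n (t : 'I_n -> point K) (h : 'I_n -> line K) u :
    (forall i, vanishes_at q (t i) /\ tangent_at q (t i) (h i)) ->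
    (forall i, u i != 0 /\ val (t i) = <[u i]>%VS) ->
    {subset codom u <= codom v ++ codom w} ->
    exists a : 'I_n -> K, forall i x, (x \in val (h i)) = ((tl Q (a i)).@[x 0] == 0).
  move=> tP uP sub; apply: (@fin_all_exists _ (fun=> K)
    (fun i a => forall x, (x \in val (h i)) = ((tl Q a).@[x 0] == 0))) => i.
  have [a aP] := QP (u i) (sub _ (codom_f u i)); exists a => x; rewrite -aP.
  have [u0 tu] := uP i; apply: (tP i).2 => //; by rewrite tu memv_line.
have [|a aP] := par _ tl_ l v tlP vP; first by move=> x xv; rewrite mem_cat xv.
have [|b bP] := par _ tm m w tmP wP; first by move=> x xw; rewrite mem_cat xw orbT.
by exists Q, a, b.
Qed.

(** * Star configurations *)

Section Stars.
Variables (K : numClosedFieldType) (Q : 'M[K]_3).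
Hypothesis Q_unit : Q \in unitmx.
Implicit Types (f g h : {mpoly K[3]}) (n k d e : nat) (A B : seq K).

Local Notation ev := (ev Q).
Local Notation rst := (rst Q).
Local Notation tl := (tl Q).

Lemma spt_neq0 (x y : K) : spt Q x y != 0.
Proof. by apply/eqP => /(pt_eq0 Q_unit)[_ _ /eqP]; rewrite oner_eq0. Qed.

Lemma dim_spt (x y : K) : \dim <[spt Q x y]> == 1%N.
Proof. by rewrite dim_vline spt_neq0. Qed.

Definition spoint (x y : K) : point K := exist _ <[spt Q x y]>%VS (dim_spt x y).

Lemma spointC (x y : K) : spoint x y = spoint y x.
Proof. by apply: val_inj; rewrite /= sptC. Qed.

Lemma incident_spoint (x y : K) (l : line K) : incident (spoint x y) l = (spt Q x y \in val l).
Proof. by rewrite memvE. Qed.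

Lemma vanishes_at_spoint n f (x y : K) : f \is n.-homog ->
  vanishes_at f (spoint x y) <-> ev f x y = 0.
Proof.
move=> fn; split=> [f0|f0 v /vlineP[c ->]]; first exact/f0/memv_line.
by rewrite (@dhomog_eval _ _ _ _ c (spt Q x y 0) _ fn) => [|i]; rewrite ?[f.@[_]]f0 ?mulr0 ?mxE.
Qed.

Section Star.
Variables (r : nat) (l : 'I_r -> line K) (a : 'I_r -> K).
Hypothesis lP : forall i w, (w \in val (l i)) = ((tl (a i)).@[w 0] == 0).
Hypothesis l_inj : injective l.

Lemma parameter_inj : injective a.
Proof. by move=> i j aij; apply/l_inj/val_inj/vspaceP => w; rewrite !lP aij. Qed.

Lemma incident_parameter (x y : K) i :
  incident (spoint x y) (l i) = (a i == x) || (a i == y).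
Proof.
rewrite incident_spoint lP -[_.@[_]]/(ev (tl (a i)) x y) (ev_tl Q_unit).
by rewrite mulf_eq0 !subr_eq0.
Qed.

Lemma star_spoint i j : i != j -> star l (spoint (a i) (a j)).
Proof.
move=> ij; apply/existsP; have [lt|lt|/val_inj/eqP] := ltngtP i j; last by rewrite (negbTE ij).
  by exists i; apply/existsP; exists j; rewrite lt !incident_parameter !eqxx orbT.
by exists j; apply/existsP; exists i; rewrite lt !incident_parameter !eqxx orbT.
Qed.

Lemma starP p : star l p -> exists i j : 'I_r, (i < j)%N /\ p = spoint (a i) (a j).
Proof.
case/existsP => i /existsP[j /and3P[ij pi pj]]; exists i, j; split=> //.
have [v v0 pv] := point_vline p.
have tv (k : 'I_r) : incident p (l k) -> (tl (a k)).@[v 0] = 0.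
  by rewrite /incident pv -memvE lP => /eqP.
have aij : a i - a j != 0.
  by rewrite subr_eq0 (inj_eq parameter_inj); apply: contraTneq ij => ->; rewrite ltnn.
have := tv i pi; have := tv j pj; rewrite /tl !mevalD !mevalN !mevalZ.
move: (pt_crd Q_unit v); set x := _.@[_]; set y := _.@[_]; set z := _.@[_] => vE ej ei.
have xE : x = (a i + a j) * z.
  apply: (mulfI aij); apply/eqP; rewrite -subr_eq0; apply/eqP.
  by rewrite -[RHS](subrr 0) -[X in _ = X - _]ej -[X in _ = _ - X]ei; ring.
have yE : y = (a i * a j) * z.
  by apply/eqP; rewrite -subr_eq0; apply/eqP; rewrite -[RHS]ei xE; ring.
have vz : v = z *: spt Q (a i) (a j).
  by rewrite vE xE yE; apply/rowP => k; rewrite [RHS]mxE !ptE; ring.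
apply/val_inj; rewrite pv /=; apply/eqP; rewrite eqEdim !dim_vline v0 spt_neq0 andbT -memvE.
by apply/vlineP; exists z.
Qed.

Lemma vanish_starP n f : f \is n.-homog ->
  (forall p, star l p -> vanishes_at f p) <-> vanish Q (codom a) f.
Proof.
move=> fn; split=> [f0 _ _ /codomP[i ->] /codomP[j ->] aij|f0 p /starP[i [j [ij ->]]]].
  by apply/(vanishes_at_spoint _ _ fn)/f0/star_spoint; apply: contraNneq aij => ->.
apply/(vanishes_at_spoint _ _ fn); apply: f0; rewrite ?codom_f // (inj_eq parameter_inj).
by apply: contraTneq ij => ->; rewrite ltnn.
Qed.

(** Two points of [Z] with a common index [i] already force the line [k] to be the tangent [i]; then
    [Z] exhausts the points of the star on it. *)
Lemma star_collinear (Z : {fset point K}) (k : line K) : (2 <= r)%N ->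
  {subset Z <= star l} -> #|` Z| = (r - 1)%N -> (forall p, p \in Z -> incident p k) ->
  exists i, forall j, j != i -> spoint (a i) (a j) \in Z.
Proof.
move=> r2 Zl cZ Zk.
have [ps [psE ps_lt]] : exists ps : seq ('I_r * 'I_r),
    enum_fset Z = [seq spoint (a p.1) (a p.2) | p <- ps] /\
    all (fun p : 'I_r * 'I_r => p.1 < p.2)%N ps.
  have : {subset enum_fset Z <= star l} by move=> p; apply: Zl.
  elim: (enum_fset Z) => [|p s IHs] sub; first by exists [::].
  have [|ps [-> ps_lt]] := IHs; first by move=> p' p's; apply: sub; rewrite inE p's orbT.
  have [i [j [ij pE]]] := starP (sub _ (mem_head _ _)).
  by exists ((i, j) :: ps); rewrite /= ps_lt ij pE.
have szZ : size (enum_fset Z) = (r - 1)%N by rewrite -cZ.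
have sz : size ps = (r - 1)%N by rewrite -szZ psE size_map.
have uZ : uniq (enum_fset Z) by apply: fset_uniq.
have inZ i j : (i, j) \in ps -> spoint (a i) (a j) \in Z.
  by move=> ij; rewrite -[_ \in Z]/(_ \in enum_fset Z) psE; apply/mapP; exists (i, j).
pose nbr i j := (i != j) && (spoint (a i) (a j) \in Z).
have [[i [j [j' [jj' ij ij']]]]|nonbr] :=
    classic (exists i j j', [/\ j != j', nbr i j & nbr i j']).
  have [/andP[nij Zij] /andP[nij' Zij']] := (ij, ij').
  have jj'_neq : spoint (a i) (a j) != spoint (a i) (a j').
    apply/eqP => e; have := incident_parameter (a i) (a j) j'; rewrite e.
    rewrite incident_parameter eqxx orbT !(inj_eq parameter_inj) ![j' == _]eq_sym.
    by rewrite (negbTE nij') (negbTE jj').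
  have kE : val k = val (l i).
    pose C := (val k :&: val (l i))%VS.
    have inC x : i != x -> spoint (a i) (a x) \in Z -> (<[spt Q (a i) (a x)]> <= C)%VS.
      move=> ix Zx; rewrite subv_cap; apply/andP; split; first exact: Zk Zx.
      by rewrite -[(_ <= _)%VS]/(incident (spoint (a i) (a x)) (l i)) incident_parameter eqxx.
    have [dC|dC] := leqP (\dim C) 1.
      case/eqP: jj'_neq; apply: val_inj => /=.
      have E x : i != x -> spoint (a i) (a x) \in Z -> <[spt Q (a i) (a x)]>%VS = C.
        by move=> ix Zx; apply/eqP; rewrite eqEdim inC //= dim_vline spt_neq0.
      by rewrite !E.
    have Ck : C = val k by apply/eqP; rewrite eqEdim capvSl (eqP (valP k)).
    have Cl : C = val (l i) by apply/eqP; rewrite eqEdim capvSr (eqP (valP (l i))).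
    by rewrite -Ck Cl.
  (* [L] lists the [r - 1] points of the star on the tangent [i]; it contains [Z], which has as many
     points. *)
  exists i; pose L := [seq spoint (a i) (a j) | j <- enum 'I_r & j != i].
  have sL : (size L <= size (enum_fset Z))%N.
    rewrite szZ size_map size_filter leq_subRL ?(ltnW r2) //.
    have := count_predC (pred1 i) (enum 'I_r).
    by rewrite (count_uniq_mem _ (enum_uniq _)) mem_enum -cardE card_ord => e;
       rewrite -[leqRHS]e.
  have subL : {subset enum_fset Z <= L}.
    move=> p; rewrite psE => /mapP[[x y] xy ->] /=.
    have : incident (spoint (a x) (a y)) (l i) by rewrite /incident -kE; apply/Zk/inZ.
    rewrite incident_parameter !(inj_eq parameter_inj) => ixy.
    have xy' : x != y by move: (allP ps_lt _ xy) => /=; apply: contraTneq => ->; rewrite ltnn.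
    case/orP: ixy => /eqP e.
      by apply/mapP; exists y; rewrite ?e // mem_filter mem_enum andbT eq_sym.
    by apply/mapP; exists x; rewrite ?e 1?spointC // mem_filter mem_enum andbT.
  have [_ ZL] := uniq_min_size uZ subL sL.
  move=> y yi; rewrite -[_ \in Z]/(_ \in enum_fset Z) ZL; apply/mapP; exists y => //.
  by rewrite mem_filter yi mem_enum.
(* Otherwise the points of [Z] pair off their [2 (r - 1)] indices, so that [r = 2]. *)
have nb x y y' : nbr x y -> nbr x y' -> y = y'.
  by move=> h h'; apply/eqP/negPn/negP => yy; case: nonbr; exists x, y, y'.
have nps p : p \in ps -> nbr p.1 p.2 /\ nbr p.2 p.1.
  case: p => x y xy /=; have xy' := allP ps_lt _ xy; rewrite /= in xy'.
  have ne : x != y by apply: contraTneq xy' => ->; rewrite ltnn.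
  by rewrite /nbr ne (spointC (a y)) (inZ _ _ xy) eq_sym ne.
have ups : uniq ps by apply: (@map_uniq _ _ (fun p => spoint (a p.1) (a p.2))); rewrite -psE.
have u : uniq (map fst ps ++ map snd ps).
  rewrite cat_uniq !map_inj_in_uniq //.
  - rewrite ups andbT; apply/hasPn => _ /mapP[[x y] xy ->]; apply/mapP => -[[x' y'] xy' /= e].
    have [_ /= n1] := nps _ xy; have [/= n2 _] := nps _ xy'; rewrite -e in n2.
    have e2 := nb _ _ _ n1 n2; have := allP ps_lt _ xy; have := allP ps_lt _ xy'.
    by rewrite /= -e -e2; move=> h1 h2; have := ltn_trans h1 h2; rewrite ltnn.
  - move=> [x y] [x' y'] xy xy' /= e; have [_ /= n1] := nps _ xy; have [_ /= n2] := nps _ xy'.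
    by rewrite e in n1 *; rewrite (nb _ _ _ n1 n2).
  move=> [x y] [x' y'] xy xy' /= e; have [/= n1 _] := nps _ xy; have [/= n2 _] := nps _ xy'.
  by rewrite e in n1 *; rewrite (nb _ _ _ n1 n2).
have : (size (map fst ps ++ map snd ps) <= r)%N.
  rewrite -[X in (_ <= X)%N]card_ord cardE; apply: uniq_leq_size => // x _.
  by rewrite mem_enum.
rewrite size_cat !size_map sz => r_le.
case: ps sz psE ps_lt inZ {nps ups u} => [|[x y] ps] /=; first by move=> sz; lia.
move=> _ _ /andP[xy _] inZ; exists x => z zx; have := inZ x y (mem_head _ _).
suff -> : z = y by [].
apply/val_inj; have /eqP : z != x by []; have := ltn_ord x; have := ltn_ord y; have := ltn_ord z.
move=> hz hy hx nzx; have {}nzx : val z <> val x by move/val_inj.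
by move: xy r_le r2 hz hy hx nzx => /=; lia.
Qed.

End Star.
End Stars.

Lemma vanishing_idealP (K : fieldType) (X : pred (point K)) n (f : {mpoly K[3]}) :
  f \is n.-homog -> vanishing_ideal X f <-> forall p, X p -> vanishes_at f p.
Proof.
move=> fn; split=> [[s [sX ->]] p Xp v vp|f0].
  rewrite rmorph_sum big_seq big1 // => x xs /=.
  by have [_ /(_ p Xp v vp) x0] := sX x xs; rewrite mevalM x0 mulr0.
exists [:: (1, f)]; split=> [x|]; last by rewrite big_seq1 mul1r.
by rewrite inE => /eqP -> /=; split; first by exists n.
Qed.

Lemma general_in_iff (K : fieldType) (V : vectType K) (W W' P : V -> Prop) :
  (forall v, W v <-> W' v) -> general_in W P -> general_in W' P.
Proof.
move=> WW [U [oU [v [Wv Uv]] UP]]; exists U; split=> //.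
  by exists v; split=> //; apply/WW.
by move=> w /WW; apply: UP.
Qed.

(** * The ideal of two stars *)

Section TwoStars.
Variables (K : numClosedFieldType) (Q : 'M[K]_3).
Hypothesis Q_unit : Q \in unitmx.
Variables (r s : nat) (l : 'I_r -> line K) (m : 'I_s -> line K).
Variables (a : 'I_r -> K) (b : 'I_s -> K).
Hypothesis lP : forall i w, (w \in val (l i)) = ((tl Q (a i)).@[w 0] == 0).
Hypothesis mP : forall i w, (w \in val (m i)) = ((tl Q (b i)).@[w 0] == 0).
Hypotheses (l_inj : injective l) (m_inj : injective m).
Hypothesis lm : forall i j, l i <> m j.
Implicit Types (f g h F G : {mpoly K[3]}).

Let A := codom a.
Let B := codom b.

Lemma uniq_parameters : uniq (A ++ B).
Proof.
have uA : uniq A by rewrite map_inj_uniq ?enum_uniq //; exact: parameter_inj lP l_inj.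
have uB : uniq B by rewrite map_inj_uniq ?enum_uniq //; exact: parameter_inj mP m_inj.
rewrite cat_uniq uA uB andbT; apply/hasPn => _ /codomP[j ->]; apply/codomP => -[i ij].
by apply: (@lm i j); apply/val_inj/vspaceP => w; rewrite lP mP ij.
Qed.

Lemma two_starsP n f : f \is n.-homog ->
  vanishing_ideal [predU star l & star m] f <-> vanish Q A f /\ vanish Q B f.
Proof.
move=> fn; rewrite (vanishing_idealP _ fn); rewrite -(vanish_starP Q_unit lP l_inj fn).
rewrite -(vanish_starP Q_unit mP m_inj fn); split=> [f0|[fl fm] p /orP[/fl|/fm] //].
by split=> p px; apply: f0; apply/orP; [left | right].
Qed.

Lemma two_stars_general n :
  general_in (fun v : dhomog 3 K n => vanish Q A v /\ vanish Q B v)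
    (fun v : dhomog 3 K n => irreducible_elt (mpoly_of_dhomog v)) ->
  general_form_irreducible [predU star l & star m] n.
Proof.
apply: general_in_iff => v; apply: iff_sym; apply: (@two_starsP n).
exact: dhomog_is_dhomog.
Qed.

Lemma two_stars_complete_intersection d e F G : F \is d.-homog -> G \is e.-homog ->
  vanish Q A F -> vanish Q B F -> vanish Q A G -> vanish Q B G ->
  no_common_component F G -> generates Q A B F G ->
  complete_intersection d e [predU star l & star m].
Proof.
move=> Fd Ge AF BF AG BG cop gen; exists F, G; split=> // h; split; last first.
  case=> t [tFG ->]; exists t; split=> // x xt; split.
    by case: (tFG x xt) => ->; [exists d | exists e].
  have [F0 G0] := ((two_starsP Fd).2 (conj AF BF), (two_starsP Ge).2 (conj AG BG)).
  by case: (tFG x xt) => ->; [apply/(vanishing_idealP _ Fd) | apply/(vanishing_idealP _ Ge)].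
case=> t [tX ->].
suff [u [w ->]] : exists u w, \sum_(x <- t) x.1 * x.2 = u * F + w * G.
  exists [:: (u, F); (w, G)]; split; last by rewrite !big_cons big_nil addr0.
  by move=> x; rewrite !inE => /orP[] /eqP ->; [left | right].
elim: t tX => [|x t IHt] tX; first by exists 0, 0; rewrite big_nil !mul0r addr0.
have [|u [w tE]] := IHt; first by move=> y yt; apply: tX; rewrite inE yt orbT.
have [[n xn] x0] := tX x (mem_head _ _).
have [xA xB] := (two_starsP xn).1 ((vanishing_idealP _ xn).2 x0).
have [u' [w' xE]] := gen n _ xn xA xB.
by exists (x.1 * u' + u), (x.1 * w' + w); rewrite big_cons tE xE; ring.
Qed.

(* [F] is the form of degree [r - 1] through both stars; [f] and [F] have the same zeros on the
   tangent [c], so that subtracting a multiple of [F] leaves [tl c * g] with [g] of degree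
   [r - 2] vanishing on the star of [A]. *)
Lemma vanish_collinear k f c : size A = k.+1 -> size B = k.+1 -> (0 < k)%N ->
  f \is k.-homog -> vanish Q A f -> c \in B ->
  (forall y, y \in B -> y != c -> ev Q f c y = 0) -> vanish Q B f.
Proof.
move=> sA sB k0 fk fA cB f0; have uAB := uniq_parameters.
have [/= uA uB AB] : [/\ uniq A, uniq B & forall x, x \in A -> x \notin B].
  move: uAB; rewrite cat_uniq => /and3P[-> /hasPn AB ->]; split=> // x xA.
  by apply/negP => /AB; rewrite /= xA.
have [F [G [Fk Gk bF _]]] := bezout_even_exists Q_unit sA sB uAB.
have [vAF _ vBF _] := bezout_even_vanish bF.
have [_] := bezout_even_rst cB (bezout_even_swap bF).
have sr : size (rem c B) = k by rewrite size_rem // sB.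
have cA : c \notin A by apply: contraL cB => /AB.
have vAF' : vanish Q A (- F) by rewrite -scaleN1r; apply: vanishZ.
have vBF' : vanish Q B (- F) by rewrite -scaleN1r; apply: vanishZ.
have Fk' : - F \is (size (rem c B)).-homog by rewrite sr rpredN.
move: (- F) vAF' vBF' Fk' => F' vAF' vBF' Fk' F'c.
have [|||e [g [gk fE]]] := tangent_residual Q_unit Fk' fk _ _ F'c.
- by rewrite rem_uniq.
- by rewrite pol_eq0.
- by move=> y; rewrite mem_rem_uniq // inE => /andP[yc yB]; apply: f0.
(* On each of the [k + 1] tangents of [A], [g] has degree [k - 1] and vanishes at [k] points, hence
   identically. *)
have g0 : g = 0.
  have gA : vanish Q A g.
    apply: (vanish_tl Q_unit cA).
    have -> : tl Q c * g = f - e * F' by rewrite fE addrC addKr.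
    by apply: vanishB => //; apply: vanishM.
  apply: (rst_eq0_homog Q_unit gk uA); first by rewrite sA prednK.
  move=> x xA; apply/eqP/negPn/negP => gx.
  have := size_rst Q_unit x gk; rewrite prednK //; apply/negP; rewrite -ltnNge.
  have sxr : size (rem x A) = k by rewrite size_rem // sA.
  rewrite -sxr; apply: max_poly_roots => //; last exact: rem_uniq.
  apply/allP => y; rewrite mem_rem_uniq // inE => /andP[yx yA].
  by rewrite rootE horner_rst gA // eq_sym.
by rewrite fE g0 mulr0 addr0; apply: vanishM.
Qed.

End TwoStars.

Theorem theorem3p1 (R : realType) (q : {mpoly R[i][3]})
  (hq : irreducible_conic q) (r s : nat) (hr : (2 <= r)%N) (hs : (2 <= s)%N)
  (l : 'I_r -> line R[i]) (m : 'I_s -> line R[i])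
  (hl : contact_lines q l) (hm : contact_lines q m)
  (l_inj : injective l) (m_inj : injective m) (lm : forall i j, l i <> m j) :
  let X := star l in
  let Y := star m in
  [/\ s = (r - 1)%N -> general_form_irreducible [predU X & Y] (r - 1),
      s = (r - 1)%N -> complete_intersection (r - 1) (r - 1) [predU X & Y],
      s = r -> general_form_irreducible [predU X & Y] r,
      s = r ->
        forall Z : {fset point R[i]},
          {subset Z <= Y} -> #|` Z| = (r - 1)%N -> collinear Z ->
          forall f : dhomog 3 R[i] (r - 1),
            vanishing_forms [predU X & Z] f <-> vanishing_forms [predU X & Y] f
    & s = r -> complete_intersection (r - 1) r [predU X & Y]].
Proof.
move=> X Y; have [Q [a [b [Qu lP mP]]]] := contact_parameters hq hr hl hm.
have uAB := uniq_parameters lP mP l_inj m_inj lm.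
have rE : r = (r - 1).+1 by lia.
have k0 : (0 < r - 1)%N by lia.
have sA : size (codom a) = (r - 1).+1 by rewrite size_codom card_ord -rE.
have sB : size (codom b) = s by rewrite size_codom card_ord.
have generalP := two_stars_general Qu lP mP l_inj m_inj.
have ciP := two_stars_complete_intersection Qu lP mP l_inj m_inj.
have odd_uAB : s = (r - 1)%N -> size (codom b) = (r - 1)%N by rewrite sB.
have even_uAB : s = r -> size (codom b) = (r - 1).+1 by rewrite sB -rE.
split.
- by move=> /odd_uAB sB'; apply/generalP/general_odd.
- move=> /odd_uAB sB'; have [F0 [F1 [F0k F1k bF gF]]] := bezout_odd_exists Qu sA sB' uAB.
  have [? ? ? ?] := bezout_odd_vanish bF.
  by apply: (ciP _ _ F0 F1) => //; apply: (bezout_odd_coprime Qu uAB); rewrite ?sB'.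
- move=> /even_uAB sB'; apply: generalP.
  by have := general_even Qu sA sB' uAB k0; rewrite -rE.
- move=> /even_uAB sB' Z ZY cZ [k Zk] f; have fk := dhomog_is_dhomog f.
  rewrite /vanishing_forms (two_starsP Qu lP mP l_inj m_inj fk) (vanishing_idealP _ fk).
  split=> [f0|[fA fB] p /orP[pX|pZ]]; last 2 first.
  + exact: (vanish_starP Qu lP l_inj fk).2 fA p pX.
  + exact: (vanish_starP Qu mP m_inj fk).2 fB p (ZY _ pZ).
  have fA : vanish Q (codom a) f.
    by apply/(vanish_starP Qu lP l_inj fk) => p pX; apply: f0; apply/orP; left.
  split=> //; have [|j jZ] := star_collinear Qu mP m_inj hs ZY _ Zk.
    by rewrite cZ; congr (_ - _)%N; rewrite -sB sB' -rE.
  apply: (vanish_collinear Qu lP mP l_inj m_inj lm sA sB' k0 fk fA (codom_f b j)).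
  move=> _ /codomP[i ->] ij; apply/(vanishes_at_spoint Qu _ _ fk)/f0.
  apply/orP; right; apply: jZ.
  by apply: contraNneq ij => ->.
move=> /even_uAB sB'; have [F [G [Fk Gk bF gF]]] := bezout_even_exists Qu sA sB' uAB.
have [? ? ? ?] := bezout_even_vanish bF.
apply: (ciP _ _ F G) => //; first by rewrite rE.
by apply: (bezout_even_coprime Qu uAB); rewrite ?sB'.
Qed.
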